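(* There exist a kernel $K\in C(\mathbb{R}^3;\mathbb{R}^{3\times3})$, a time $T>0$, and a time-dependent locally finite $\mathbb{R}^3$-valued Borel measure $\omega=\omega(t)$, $t\in[0,T]$, on $\mathbb{R}^3$ whose distributional divergence $\nabla\cdot\omega(t)$ is a locally finite signed Borel measure for each $t$, such that the velocity $$u(t,x)\coloneqq\int_{\mathbb{R}^3}K(x-y)\,d\omega(t)(y)$$ is continuous and weakly divergence free, $\omega$ is weakly advected by $u$ on $[0,T]$ in the sense of the vector weak advection definition below, $\dim_H\mathrm{supp}\,\omega(0)=1$, and $\dim_H\mathrm{supp}\,\omega(T)=2$.
   Context: Vector weak advection with stretching: Let $T>0$ and $u:[0,T]\times\mathbb{R}^3\to\mathbb{R}^3$ be continuous. A family $\omega(t)$, $t\in[0,T]$, of locally finite $\mathbb{R}^3$-valued Borel measures with locally finite distributional divergence $\nabla\cdot\omega(t)$ (defined by $\langle\varphi,\nabla\cdot\omega(t)\rangle=-\int\nabla\varphi\cdot d\omega(t)$) is weakly advected by $u$ on $[0,T]$ if for all $\phi\in C_c^\infty([0,T]\times\mathbb{R}^3;\mathbb{R}^3)$ $$\int_0^T\!\!\int\partial_t\phi\cdot d\omega(t)\,dt-\int\phi(T,\cdot)\cdot d\omega(T)+\int\phi(0,\cdot)\cdot d\omega(0)+\int_0^T\!\!\int((u\cdot\nabla)\phi)\cdot d\omega(t)\,dt-\int_0^T\!\!\int((\nabla\phi)^\top u)\cdot d\omega(t)\,dt-\int_0^T\langle\phi(t,\cdot)\cdot u(t,\cdot),\nabla\cdot\omega(t)\rangle\,dt=0.$$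 Here $(\nabla\phi)^\top u$ denotes the vector with components $\sum_j \partial_i\phi_j\,u_j$. $\dim_H$ denotes Hausdorff dimension. *)

(* Defs.v *)
From HB Require Import structures.
From mathcomp Require Import all_boot all_order all_algebra.
From mathcomp Require Import all_classical all_reals all_analysis.
Set Implicit Arguments. Unset Strict Implicit. Unset Printing Implicit Defensive.
Import Order.TTheory GRing.Theory Num.Theory.
Import numFieldNormedType.Exports.
Local Open Scope classical_set_scope.
Local Open Scope ring_scope.

Section Defs.
Context {R : realType}.

(* R^3 is modelled as (R * R) * R : it carries the product (= Borel)
   sigma-algebra, and a normed-module structure (max norm, which induces
   the usual topology).  Vectors in R^3 are elements of the same type.   *)
Definition R3 := ((R * R) * R)%type.

Definition vec3 (F : 'I_3 -> R) : R3 :=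
  ((F (@Ordinal 3 0 isT), F (@Ordinal 3 1 isT)), F (@Ordinal 3 2 isT)).

Definition coord (i : 'I_3) (x : R3) : R :=
  match val i with 0%N => x.1.1 | 1%N => x.1.2 | _ => x.2 end.

Definition dot (a b : R3) : R := \sum_(i < 3) coord i a * coord i b.

Definition enorm (x : R3) : R := Num.sqrt (dot x x).

Definition ebasis (i : 'I_3) : R3 := vec3 (fun j => if j == i then 1 else 0).

Definition leb3 := ((@lebesgue_measure R \x @lebesgue_measure R) \x @lebesgue_measure R)%E.

Fixpoint iterD {V W : normedModType R} (vs : seq V) (f : V -> W) : V -> W :=
  match vs with
  | [::] => f
  | v :: vs' => 'D_v (iterD vs' f)
  end.

Definition smooth {V W : normedModType R} (f : V -> W) : Prop :=
  forall (vs : seq V) (x : V), differentiable (iterD vs f) x.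

Definition compact_support {V W : normedModType R} (f : V -> W) : Prop :=
  exists r : R, forall x : V, r < `|x| -> f x = 0.

Definition test_fun {V W : normedModType R} (f : V -> W) : Prop :=
  smooth f /\ compact_support f.

Definition grad (psi : R3 -> R) (x : R3) : R3 :=
  vec3 (fun i => 'D_(ebasis i) psi x).

Definition locally_finite (mu : {measure set R3 -> \bar R}) : Prop :=
  forall r : R, (mu [set x | (enorm x <= r)%R] < +oo)%E.

(* A locally finite signed Borel measure on R^3 is represented as the
   difference mp - mn of two locally finite (positive) Borel measures;
   an R^3-valued one by such a pair for each component j : 'I_3. *)

Definition sint (mp mn : {measure set R3 -> \bar R}) (f : R3 -> R) : R :=
  Rintegral mp setT f - Rintegral mn setT f.

Definition vint (mp mn : 'I_3 -> {measure set R3 -> \bar R}) (phi : R3 -> R3) : R :=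
  \sum_(j < 3) sint (mp j) (mn j) (fun x => coord j (phi x)).

(* support of the vector measure omega = (mp j - mn j)_j : the complement of
   the largest open set on which omega vanishes *)
Definition vsupp (mp mn : 'I_3 -> {measure set R3 -> \bar R}) : set R3 :=
  [set x | forall r : R, 0 < r -> exists (A : set R3) (j : 'I_3),
     [/\ measurable A, A `<=` ball x r & mp j A <> mn j A]].

Definition is_divergence (mp mn : 'I_3 -> {measure set R3 -> \bar R})
    (np nn : {measure set R3 -> \bar R}) : Prop :=
  forall psi : R3 -> R, test_fun psi ->
    sint np nn psi = - vint mp mn (grad psi).

Definition diam (A : set R3) : \bar R :=
  ereal_sup [set (enorm (x - y))%:E | x in A & y in A].

Definition hterm (s : R) (C : set R3) : \bar R :=
  if asbool (C = set0) then 0%E else ((fine (diam C)) `^ s)%:E.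

Definition hcover (delta : R) (A : set R3) (C : nat -> set R3) : Prop :=
  A `<=` \bigcup_n C n /\ forall n, (diam (C n) <= delta%:E)%E.

Definition hausdorff_pre (s delta : R) (A : set R3) : \bar R :=
  ereal_inf [set (\sum_(0 <= n <oo) hterm s (C n))%E | C in hcover delta A].

Definition hausdorff_measure (s : R) (A : set R3) : \bar R :=
  ereal_sup [set hausdorff_pre s delta A | delta in [set d : R | 0 < d]].

Definition hausdorff_dim (A : set R3) : \bar R :=
  ereal_inf [set s%:E | s in [set s : R | 0 <= s /\ hausdorff_measure s A = 0%E]].

Definition velocity (K : 'I_3 -> 'I_3 -> R3 -> R)
    (mp mn : R -> 'I_3 -> {measure set R3 -> \bar R}) (t : R) (x : R3) : R3 :=
  vec3 (fun i => \sum_(j < 3) sint (mp t j) (mn t j) (fun y => K i j (x - y))).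

Definition dt (phi : R * R3 -> R3) (t : R) (x : R3) : R3 :=
  'D_((1, 0) : R * R3) phi (t, x).
Definition dx (i : 'I_3) (phi : R * R3 -> R3) (t : R) (x : R3) : R3 :=
  'D_((0, ebasis i) : R * R3) phi (t, x).

Definition adv_term (u : R -> R3 -> R3) (phi : R * R3 -> R3) (t : R) (x : R3) : R3 :=
  vec3 (fun j => \sum_(i < 3) coord i (u t x) * coord j (dx i phi t x)).

Definition str_term (u : R -> R3 -> R3) (phi : R * R3 -> R3) (t : R) (x : R3) : R3 :=
  vec3 (fun i => \sum_(j < 3) coord j (dx i phi t x) * coord j (u t x)).

(* omega(t) = (mp t j - mn t j)_j, div omega(t) = np t - nn t *)
Definition weakly_advected (T : R) (u : R -> R3 -> R3)
    (mp mn : R -> 'I_3 -> {measure set R3 -> \bar R})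
    (np nn : R -> {measure set R3 -> \bar R}) : Prop :=
  forall phi : R * R3 -> R3, test_fun phi ->
    let F1 t := vint (mp t) (mn t) (dt phi t) in
    let F2 t := vint (mp t) (mn t) (adv_term u phi t) in
    let F3 t := vint (mp t) (mn t) (str_term u phi t) in
    let F4 t := sint (np t) (nn t) (fun x => dot (phi (t, x)) (u t x)) in
    [/\ lebesgue_measure.-integrable `[0, T] (EFin \o F1),
        lebesgue_measure.-integrable `[0, T] (EFin \o F2),
        lebesgue_measure.-integrable `[0, T] (EFin \o F3),
        lebesgue_measure.-integrable `[0, T] (EFin \o F4) &
      Rintegral lebesgue_measure `[0, T] F1
      - vint (mp T) (mn T) (fun x => phi (T, x))
      + vint (mp 0) (mn 0) (fun x => phi (0, x))
      + Rintegral lebesgue_measure `[0, T] F2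
      - Rintegral lebesgue_measure `[0, T] F3
      - Rintegral lebesgue_measure `[0, T] F4 = 0].

End Defs.

(* Main.v *)
(* The current [omega (t)] only has a third component: it is the superposition of
   the vertical unit segments over the points [(c, c)] of the plane, where [c] runs
   over the positions at time [t] of a one-dimensional interacting particle system.
   Half of the particles rest at 0 and push the other half, which starts at 1, with
   the velocity field [2 sqrt (x - 1)].  This field is continuous but not Lipschitz,
   so the particles may leave 1 one after the other: two segments at time 0 become
   a piece of a plane at time 1.  Since the kernel vanishes on (-oo, 1], the moving
   particles do not interact.  The velocity [(v (t, x2), v (t, x1), 0)] is divergence
   free as no component depends on its own variable.  Weak advection is the
   fundamental theorem of calculus in time for the transport terms; the stretching
   term cancels the divergence term by the fundamental theorem along the segments. *)
Require Import Defs.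
From HB Require Import structures.
From mathcomp Require Import all_boot all_order all_algebra.
From mathcomp Require Import all_classical all_reals all_analysis.
From mathcomp Require Import measurable_realfun ring lra zify.
Set Implicit Arguments. Unset Strict Implicit. Unset Printing Implicit Defensive.
Import Order.TTheory GRing.Theory Num.Theory.
Import numFieldNormedType.Exports.
Local Open Scope classical_set_scope.
Local Open Scope ring_scope.
(* Not [vector.coord], which shadows it. *)
Local Notation coord := Defs.coord.

(** * Borel sets of finite products of the real line *)

(** A point [(c, c)] sees the same value [c] in both horizontal variables, so exchanging these
    variables between the two velocity components changes nothing on the diagonal. This is how a
    one-dimensional law of motion, itself not divergence free, becomes the trace of a divergence
    free field, and the transport terms see the field only at the particles. The constants fit
    together as follows. Labels [s] are uniform on [[0, 1]], those above 1/2 resting at the origin.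
    Each function [1 + (t - c) ^ 2], continued by 1 before time [c], solves [x' = 2 sqrt (x - 1)],
    and a mass 1/2 at the origin produces this field when the kernel is [4 sqrt (z - 1)]. Departure
    at time [2 s] spreads the labels up to 1/2 evenly over [[0, 1]]. Until time 1 no particle passes
    2, so the moving ones stay within the distance at which the kernel vanishes; the particles at
    the origin have nothing to their left and are not pushed either. At time 1 the positions of the
    moving half fill [[1, 2]]. *)

Definition measurable_basis (T : topologicalType) (M : set (set T)) : Prop :=
  exists (I : countType) (B : I -> set T), (forall i, M (B i)) /\
    forall U, open U -> forall x, U x -> exists i, B i x /\ B i `<=` U.

Lemma measurable_basis_real (R : realType) :
  @measurable_basis R (@measurable _ (measurableTypeR R)).
Proof.
exists (rat * rat)%type, (fun q => `]ratr q.1, ratr q.2[%classic); split=> [i|U oU x Ux].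
  exact: measurable_itv.
have /nbhs_ballP[e /= e0 eU] : nbhs x U by exact: open_nbhs_nbhs.
have /rat_in_itvoo[p /itvP pe] : x - e < x by rewrite ltrBlDr ltrDl.
have /rat_in_itvoo[q /itvP qe] : x < x + e by rewrite ltrDl.
exists (p, q); split => [|y]; rewrite /= in_itv/= ?pe ?qe// => /andP[py yq].
apply: eU; rewrite /ball/= ltr_distlC; apply/andP; split.
  by rewrite (lt_trans _ py)// pe.
by rewrite (lt_trans yq)// qe.
Qed.

Lemma measurable_basis_prod (T1 T2 : topologicalType) (M1 : set (set T1))
    (M2 : set (set T2)) (M : set (set (T1 * T2))) :
  (forall A B, M1 A -> M2 B -> M (A `*` B)) ->
  measurable_basis M1 -> measurable_basis M2 ->
  measurable_basis M.
Proof.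
move=> MX [I1 [B1 [mB1 bB1]]] [I2 [B2 [mB2 bB2]]].
exists (I1 * I2)%type, (fun i => B1 i.1 `*` B2 i.2); split=> [i|U oU [x y] Uxy].
  exact: MX.
have [[P Q] /= [nP nQ] PQU] : nbhs (x, y) U by exact: open_nbhs_nbhs.
have [] := bB1 (interior P) (@open_interior _ P) x; first exact: nP.
have [] := bB2 (interior Q) (@open_interior _ Q) y; first exact: nQ.
move=> j [Bj jQ] i [Bi iP]; exists (i, j); split => // -[a b] /= [Ba Bb].
by apply: PQU; split=> /=; apply: interior_subset; [apply: iP|apply: jQ].
Qed.

(** An open set is the union of the basic sets that it contains, and [unpickle] lists these as a
    sequence. [M] is a bare family of sets, so that it can be the sigma-algebra of
    [measurableTypeR R] while the topology is that of [R]. *)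
Lemma measurable_basis_open (T : topologicalType) (M : set (set T)) (U : set T) :
    M set0 -> (forall F : nat -> set T, (forall n, M (F n)) -> M (\bigcup_n F n)) ->
  measurable_basis M -> open U -> M U.
Proof.
move=> M0 Mcup [I [B [mB bB]]] oU.
pose F n := if unpickle n is Some i then
  if asbool (B i `<=` U) then B i else set0 else set0.
have -> : U = \bigcup_n F n.
  apply/seteqP; split=> [x Ux|x [n _]].
    have [i [Bix BiU]] := bB _ oU _ Ux.
    by exists (pickle i) => //; rewrite /F pickleK asboolT.
  rewrite /F; case: unpickle => // i; case: asboolP => // BiU; exact: BiU.
by apply: Mcup => n; rewrite /F; case: unpickle => // i; case: asboolP.
Qed.

Section borel_products.
Context {R : realType}.

Lemma measurable_basis_R2 : @measurable_basis (R * R)%type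
  (@measurable _ (measurableTypeR R * measurableTypeR R)%type).
Proof.
apply: measurable_basis_prod; [|exact: measurable_basis_real..].
by move=> A B mA mB; apply: measurableX.
Qed.

Lemma measurable_basis_R3 : @measurable_basis (@R3 R)
  (@measurable _ (measurableTypeR R * measurableTypeR R * measurableTypeR R)%type).
Proof.
apply: measurable_basis_prod; [|exact: measurable_basis_R2|exact: measurable_basis_real].
by move=> A B mA mB; apply: measurableX.
Qed.

Lemma measurable_basis_RR3 : @measurable_basis (R * @R3 R)%type
  (@measurable _ (measurableTypeR R *
     (measurableTypeR R * measurableTypeR R * measurableTypeR R))%type).
Proof.
apply: measurable_basis_prod; [|exact: measurable_basis_real|exact: measurable_basis_R3].
by move=> A B mA mB; apply: measurableX.
Qed.

Lemma open_measurable_R3 (U : set (@R3 R)) : open U -> measurable U.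
Proof.
apply: measurable_basis_open measurable_basis_R3 => // F mF.
exact: bigcupT_measurable.
Qed.

Lemma open_measurable_RR3 (U : set (R * @R3 R)) : open U -> measurable U.
Proof.
apply: measurable_basis_open measurable_basis_RR3 => // F mF.
exact: bigcupT_measurable.
Qed.

Lemma open_measurable_R2 (U : set (R * R)) : open U -> measurable U.
Proof.
apply: measurable_basis_open measurable_basis_R2 => // F mF.
exact: bigcupT_measurable.
Qed.

Lemma continuous_measurable_R2 (f : R * R -> R) : continuous f -> measurable_fun setT f.
Proof.
move=> /continuousP cf; apply: (measurability _ (RGenOInfty.measurableE R)).
move=> _ [_ [a ->] <-]; rewrite setTI; apply: open_measurable_R2.
exact/cf/interval_open.
Qed.

Lemma continuous_measurable_R3 (f : @R3 R -> R) : continuous f -> measurable_fun setT f.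
Proof.
move=> /continuousP cf; apply: (measurability _ (RGenOInfty.measurableE R)).
move=> _ [_ [a ->] <-]; rewrite setTI; apply: open_measurable_R3.
exact/cf/interval_open.
Qed.

Lemma continuous_measurable_RR3 (f : R * @R3 R -> R) :
  continuous f -> measurable_fun setT f.
Proof.
move=> /continuousP cf; apply: (measurability _ (RGenOInfty.measurableE R)).
move=> _ [_ [a ->] <-]; rewrite setTI; apply: open_measurable_RR3.
exact/cf/interval_open.
Qed.

Lemma compact_bounded_image {T : topologicalType} (f : T -> R) (A : set T) :
  compact A -> continuous f -> exists C, forall x, A x -> `|f x| <= C.
Proof.
move=> cA cf; have : compact (f @` A).
  by apply: continuous_compact => //; apply: continuous_subspaceT.
move=> /(@compact_bounded R R) [C [_ hC]]; exists (`|C| + 1) => x Ax.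
by apply: hC; [rewrite ltr_pwDr// ler_norm|exists x].
Qed.

Lemma continuous_bounded_R3 (f : @R3 R -> R) (r : R) : continuous f ->
  exists C, forall x, `|x.1.1| <= r -> `|x.1.2| <= r -> `|x.2| <= r -> `|f x| <= C.
Proof.
move=> cf.
have [|C hC] := @compact_bounded_image (@R3 R) f
    ((`[- r, r]%classic `*` `[- r, r]%classic) `*` `[- r, r]%classic) _ cf.
  by do! apply: compact_setX; apply: segment_compact.
by exists C => x h1 h2 h3; apply: hC; rewrite /= !in_itv/= -!ler_norml.
Qed.

Lemma continuous_bounded_RR3 (f : R * @R3 R -> R) (r : R) : continuous f ->
  exists C, forall t x, `|t| <= r -> `|x.1.1| <= r -> `|x.1.2| <= r -> `|x.2| <= r ->
    `|f (t, x)| <= C.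
Proof.
move=> cf.
have [|C hC] := @compact_bounded_image (R * @R3 R)%type f (`[- r, r]%classic `*`
    ((`[- r, r]%classic `*` `[- r, r]%classic) `*` `[- r, r]%classic)) _ cf.
  by do! apply: compact_setX; apply: segment_compact.
by exists C => t x h0 h1 h2 h3; apply: hC; rewrite /= !in_itv/= -!ler_norml.
Qed.

Lemma bounded_measurable_integrable d (T : measurableType d)
    (mu : {measure set T -> \bar R}) (D : set T) (f : T -> R) (C : R) :
  measurable D -> (mu D < +oo)%E -> measurable_fun D f ->
  (forall x, D x -> `|f x| <= C) -> mu.-integrable D (EFin \o f).
Proof.
move=> mD fD mf bf; apply: measurable_bounded_integrable => //.
by exists C; split=> [|M CM x Dx]; [rewrite num_real|exact: le_trans (bf _ Dx) (ltW CM)].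
Qed.

End borel_products.

(** * Bounded integrands, Fubini for probabilities and the uniform law *)

Section bounded_integrals.
Context {R : realType}.

Section prob.
Context d (T : measurableType d) (P : probability T R).

Lemma prob_integrable (f : T -> R) (C : R) : measurable_fun setT f ->
  (forall x, `|f x| <= C) -> P.-integrable setT (EFin \o f).
Proof.
move=> mf bf; apply: (@bounded_measurable_integrable _ _ _ _ _ _ C) => //.
by rewrite (_ : _ setT = 1%E) ?ltry//; exact: (@probability_setT _ _ _ P).
Qed.

Lemma prob_Rintegral_cst (r : R) : Rintegral P setT (fun=> r) = r.
Proof.
rewrite Rintegral_cst// (_ : _ setT = 1%E) ?mulr1//.
exact: (@probability_setT _ _ _ P).
Qed.

Lemma prob_Rintegral_bound (f : T -> R) (C : R) : measurable_fun setT f ->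
  (forall x, `|f x| <= C) -> `|Rintegral P setT f| <= C.
Proof.
move=> mf bf; have pf := prob_integrable mf bf.
apply: le_trans (le_normr_Rintegral measurableT pf) _.
have -> : C = Rintegral P setT (cst C).
  by rewrite prob_Rintegral_cst.
apply: le_Rintegral => //.
- apply: (@prob_integrable _ C) => [|x]; first exact: measurableT_comp.
  by rewrite normr_id.
- by apply: (@prob_integrable _ `|C|) => [|x]//; exact: measurable_cst.
Qed.

End prob.

Section fubini.
Context d1 d2 (T1 : measurableType d1) (T2 : measurableType d2).
Context (P1 : probability T1 R) (P2 : probability T2 R).
Context {f : T1 * T2 -> R} {C : R} (mf : measurable_fun setT f) (bf : forall x, `|f x| <= C).

Lemma prob_integrable2 : (P1 \x P2)%E.-integrable setT (EFin \o f).
Proof. exact: (@prob_integrable _ _ (P1 \x P2)%E _ C). Qed.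

Lemma prob_Rintegral_fin1 x : (\int[P2]_y (f (x, y))%:E =
  (Rintegral P2 setT (fun y => f (x, y)))%:E)%E.
Proof.
rewrite /Rintegral fineK//; apply: integrable_fin_num => //.
apply: (@prob_integrable _ _ _ (fun y => f (x, y)) C) => //.
exact: measurableT_comp.
Qed.

Lemma measurable_prob_Rintegral1 :
  measurable_fun setT (fun x => Rintegral P2 setT (fun y => f (x, y))).
Proof.
apply: measurableT_comp; first exact: fine_measurable.
exact: (measurable_fubini_F prob_integrable2).
Qed.

Lemma prob_Rintegral12 : Rintegral (P1 \x P2)%E setT f =
  Rintegral P1 setT (fun x => Rintegral P2 setT (fun y => f (x, y))).
Proof.
rewrite {1}/Rintegral -(integral12_prod_meas1 prob_integrable2) {1}/Rintegral.
by congr fine; apply: eq_integral => x _; exact: prob_Rintegral_fin1.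
Qed.

Lemma prob_Rintegral21 : Rintegral (P1 \x P2)%E setT f =
  Rintegral P2 setT (fun y => Rintegral P1 setT (fun x => f (x, y))).
Proof.
rewrite {1}/Rintegral -(integral21_prod_meas1 prob_integrable2) {1}/Rintegral.
congr fine; apply: eq_integral => y _; rewrite /fubini_G /Rintegral fineK//.
apply: integrable_fin_num => //.
apply: (@prob_integrable _ _ _ (fun x => f (x, y)) C) => //.
exact: measurableT_comp.
Qed.

End fubini.

Lemma prob_Rintegral_fst d1 d2 (T1 : measurableType d1) (T2 : measurableType d2)
    (P1 : probability T1 R) (P2 : probability T2 R) (f : T1 -> R) C :
  measurable_fun setT f -> (forall x, `|f x| <= C) ->
  Rintegral (P1 \x P2)%E setT (fun x => f x.1) = Rintegral P1 setT f.
Proof.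
move=> mf bf; rewrite (@prob_Rintegral12 _ _ _ _ _ _ _ C)//; last first.
  exact: measurableT_comp.
by apply: eq_Rintegral => x _ /=; rewrite prob_Rintegral_cst.
Qed.

(* [R] and [measurableTypeR R] have the same measurable sets but distinct displays;
   the uniform law is transported from the latter to the former. *)
Let idR : measurableTypeR R -> R := idfun.

Let measurable_idR : measurable_fun setT idR.
Proof. exact: measurable_id. Qed.

HB.instance Definition _ :=
  @isMeasurableFun.Build _ _ (measurableTypeR R) R idR measurable_idR.

Definition unif : probability R R :=
  distribution (uniform_prob (@ltr01 R) : probability (measurableTypeR R) R) idR.

Lemma unif_itv (A : set R) : measurable A ->
  unif A = lebesgue_measure (A `&` `[0, 1]).
Proof.
move=> mA; rewrite /unif/= /distribution /pushforward preimage_id /uniform_prob integral_uniform_pdf.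
rewrite (eq_integral (cst 1%E)); last first.
  move=> x; rewrite inE => -[_]; rewrite /= in_itv/= => x01.
  by rewrite /uniform_pdf x01 subr0 invr1.
by rewrite integral_cst ?mul1e//; apply: measurableI.
Qed.

Lemma unif_Rintegral (g : R -> R) (C : R) : measurable_fun setT g ->
  (forall x, `|g x| <= C) -> Rintegral unif setT g = Rintegral lebesgue_measure `[0, 1] g.
Proof.
move=> mg bg; rewrite /Rintegral; congr fine.
have mEg : measurable_fun setT (EFin \o g) by exact/measurable_EFinP.
rewrite integralE [RHS]integralE /unif/=.
rewrite ge0_integral_distribution//; last exact: measurable_funepos.
rewrite ge0_integral_distribution//; last exact: measurable_funeneg.
have iu (h : R -> \bar R) : measurable_fun setT h -> (forall x, 0 <= h x)%E ->
    (\int[uniform_prob (@ltr01 R)]_x (h \o idR) x =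
     \int[lebesgue_measure]_(x in `[0%R, 1%R]) h x)%E.
  by move=> mh h0; rewrite integral_uniform// ?subr0 ?invr1 ?mul1e//.
by congr (_ - _)%E; apply: iu => //; [exact: measurable_funepos|exact: measurable_funeneg].
Qed.

End bounded_integrals.

(** * The flow of the example *)

Section flow.
Context {R : realType}.
Implicit Types t s x z : R.

(** Times and labels are projected onto [[0, 1]], so that the bounds and Lipschitz estimates below
    hold for all reals. *)
Definition clamp x : R := Num.max 0 (Num.min x 1).

Lemma clamp_ge0 x : 0 <= clamp x.
Proof. by rewrite /clamp le_max lexx. Qed.

Lemma clamp_le1 x : clamp x <= 1.
Proof. by rewrite /clamp ge_max ler01 ge_min lexx orbT. Qed.

Lemma clamp_id x : 0 <= x <= 1 -> clamp x = x.
Proof. by move=> /andP[x0 x1]; rewrite /clamp (min_idPl x1) (max_idPr x0). Qed.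

Lemma clamp_lipschitz x y : `|clamp x - clamp y| <= `|x - y|.
Proof.
rewrite /clamp /Num.max /Num.min.
have := ler_norm (x - y); have := ler_norm (y - x).
rewrite (distrC y); move: `|x - y| => d yx xy; rewrite ler_norml; apply/andP.
by case: (ltrP x 1) => ?; case: (ltrP y 1) => ?; do 2 (case: ltrP => ?); lra.
Qed.

(* the elapsed time since the departure at time [2 s] of the particle [s] *)
Definition lag t s : R := Num.max 0 (clamp t - 2 * clamp s).

Lemma lag_ge0 t s : 0 <= lag t s.
Proof. by rewrite /lag le_max lexx. Qed.

Lemma lag_le1 t s : lag t s <= 1.
Proof.
rewrite /lag ge_max ler01/=.
by have := clamp_ge0 s; have := clamp_le1 t; lra.
Qed.

Lemma lag_lipschitz t t' s s' : `|lag t s - lag t' s'| <= `|t - t'| + 2 * `|s - s'|.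
Proof.
apply: (@le_trans _ _ (`|clamp t - clamp t'| + 2 * `|clamp s - clamp s'|)).
  rewrite /lag /Num.max; set a := clamp t; set b := clamp t'.
  set c := clamp s; set e := clamp s'.
  have := ler_norm (a - b); have := ler_norm (b - a); rewrite (distrC b).
  have := ler_norm (c - e); have := ler_norm (e - c); rewrite (distrC e).
  move: `|a - b| `|c - e| => p q ? ? ? ?; rewrite ler_norml; apply/andP.
  by do 2 (case: ltrP => ?); lra.
by rewrite lerD ?ler_pM2l// clamp_lipschitz.
Qed.

(** The departure time [2 * clamp s] is then at least 1, which the clamped time never exceeds. *)
Lemma lag_eq0 t s : 1 < 2 * s -> lag t s = 0.
Proof.
move=> s1; apply/max_idPl; rewrite subr_le0.
apply: le_trans (clamp_le1 t) _; rewrite /clamp /Num.max /Num.min.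
case: (ltrP s 1) => ?; case: ltrP => ?; lra.
Qed.

(* Particles with [2 s > 1] stay at the origin; the others wait at [1] until time
   [2 s] and then leave it as [1 + (t - 2 s) ^ 2]. *)
Definition pos t s : R := (if 2 * s <= 1 then 1 else 0) + lag t s ^+ 2.

Lemma pos_ge0 t s : 0 <= pos t s.
Proof. by rewrite /pos addr_ge0 ?sqr_ge0//; case: ifP. Qed.

Lemma pos_le2 t s : pos t s <= 2.
Proof.
have := lag_le1 t s; have := lag_ge0 t s; rewrite /pos.
by case: ifP => _; nra.
Qed.

Lemma pos_lipschitz t t' s : `|pos t s - pos t' s| <= 2 * `|t - t'|.
Proof.
rewrite /pos opprD addrACA subrr add0r subr_sqr normrM mulrC ler_pM//.
  rewrite ger0_norm ?addr_ge0 ?lag_ge0//.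
  by have := lag_le1 t s; have := lag_le1 t' s; lra.
by have := lag_lipschitz t t' s s; rewrite subrr normr0 mulr0 addr0.
Qed.

(* Chosen so that a mass [1/2] at the origin moves a particle at [x > 1] by
   [x' = 2 sqrt (x - 1)], of which [1 + (t - 2 s) ^ 2] is a solution for every [s]. *)
Definition kern z : R := 4 * Num.sqrt (z - 1).

Lemma kern_ge0 z : 0 <= kern z.
Proof. by rewrite /kern mulr_ge0 ?sqrtr_ge0. Qed.

Lemma kern_eq0 z : z <= 1 -> kern z = 0.
Proof. by move=> z1; rewrite /kern ler0_sqrtr ?mulr0// subr_le0. Qed.

(** For [0 < z <= x] the square of the left side is [x + z - 2 sqrt x sqrt z], at most [x - z]
    because [sqrt z <= sqrt x]. *)
Lemma sqrt_holder x z : `|Num.sqrt x - Num.sqrt z| <= Num.sqrt `|x - z|.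
Proof.
wlog xz : x z / z <= x => [H|].
  have [/H//|/ltW zx] := leP z x.
  by rewrite distrC [in X in _ <= X]distrC; exact: H.
have sxz : Num.sqrt z <= Num.sqrt x by exact: ler_wsqrtr.
rewrite ger0_norm ?subr_ge0// (ger0_norm (_ : 0 <= x - z)) ?subr_ge0//.
have [z0|z0] := leP z 0.
  rewrite (ler0_sqrtr z0) subr0; apply: ler_wsqrtr; lra.
rewrite -(@ler_pXn2r _ 2)// ?nnegrE ?sqrtr_ge0 ?subr_ge0//.
rewrite sqr_sqrtr ?subr_ge0//.
have hz := sqr_sqrtr (ltW z0); have hx := sqr_sqrtr (le_trans (ltW z0) xz).
have := sqrtr_ge0 z; nra.
Qed.

Lemma kern_holder x z : `|kern x - kern z| <= 4 * Num.sqrt `|x - z|.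
Proof.
rewrite /kern -mulrBr normrM ger0_norm// ler_pM2l//.
by apply: le_trans (sqrt_holder _ _) _; rewrite opprB addrA subrK.
Qed.

Lemma kern_le x z : x <= z -> kern x <= kern z.
Proof. by move=> xz; rewrite /kern ler_pM2l// ler_wsqrtr// lerB. Qed.

Lemma holder_continuous (f : R -> R) (C : R) :
  (forall x y, `|f x - f y| <= C * Num.sqrt `|x - y|) -> continuous f.
Proof.
move=> fC x; apply/cvgrPdist_le => e e0.
have C0 : 0 < `|C| + 1 by rewrite ltr_pwDr.
near=> y; apply: le_trans (fC x y) _.
have : `|x - y| <= (e / (`|C| + 1)) ^+ 2.
  near: y; apply: cvgr_dist_le; first exact: cvg_id.
  by rewrite exprn_gt0// divr_gt0.
move=> /ler_wsqrtr; rewrite sqrtr_sqr (ger0_norm (_ : 0 <= e / (`|C| + 1))); last first.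
  by rewrite ltW// divr_gt0.
rewrite ler_pdivlMr// mulrC; apply: le_trans.
by apply: ler_wpM2r; rewrite ?sqrtr_ge0// (le_trans (ler_norm _))// lerDl.
Unshelve. all: by end_near. Qed.

Lemma continuous_kern : continuous kern.
Proof. exact: holder_continuous kern_holder. Qed.

Lemma measurable_clamp : measurable_fun setT clamp.
Proof.
apply: measurable_maxr; first exact: measurable_cst.
by apply: measurable_minr; [exact: measurable_id|exact: measurable_cst].
Qed.

Lemma measurable_lag : measurable_fun setT (fun p : R * R => lag p.1 p.2).
Proof.
apply: measurable_maxr; first exact: measurable_cst.
apply: measurable_funB; first exact: (measurableT_comp measurable_clamp).
by apply: measurable_funM => //; exact: (measurableT_comp measurable_clamp).
Qed.

Lemma measurable_pos : measurable_fun setT (fun p : R * R => pos p.1 p.2).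
Proof.
apply: measurable_funD; last exact: measurable_funX measurable_lag.
apply: measurable_fun_ifT; [|exact: measurable_cst..].
by apply: measurable_fun_ler => //; apply: measurable_funM.
Qed.

Lemma measurable_pos1 t : measurable_fun setT (pos t).
Proof.
apply: (measurableT_comp measurable_pos (_ : measurable_fun setT (fun s => (t, s)))).
exact: pair1_measurable.
Qed.

(** [p.1] is the label of a particle and [p.2] the height on its segment; the current is the image
    of the uniform law on such pairs. *)
Definition flow t (p : R * R) : @R3 R := ((pos t p.1, pos t p.1), clamp p.2).

Lemma measurable_flow2 : measurable_fun setT (fun q : R * (R * R) => flow q.1 q.2).
Proof.
have mp : measurable_fun setT (fun q : R * (R * R) => pos q.1 q.2.1).
  apply: (measurableT_comp measurable_pos
    (_ : measurable_fun setT (fun q : R * (R * R) => (q.1, q.2.1)))).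
  by apply: measurable_fun_pair => //; exact: measurableT_comp.
rewrite /flow; apply: measurable_fun_pair; first exact: measurable_fun_pair.
by apply: (measurableT_comp measurable_clamp); exact: measurableT_comp.
Qed.

Lemma measurable_flow t : measurable_fun setT (flow t).
Proof.
apply: (measurableT_comp measurable_flow2
  (_ : measurable_fun setT (fun p : R * R => (t, p)))).
exact: pair1_measurable.
Qed.

HB.instance Definition _ t := isMeasurableFun.Build _ _ _ _ (flow t) (measurable_flow t).

(** The horizontal section of the current at height [z]; the sections at 0 and 1 carry its
    divergence. *)
Definition edge z t s : @R3 R := ((pos t s, pos t s), z).

Lemma measurable_edge z t : measurable_fun setT (edge z t).
Proof.
apply: measurable_fun_pair; last exact: measurable_cst.
by apply: measurable_fun_pair; exact: measurable_pos1.
Qed.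

HB.instance Definition _ z t :=
  isMeasurableFun.Build _ _ _ _ (edge z t) (measurable_edge z t).

End flow.

(** * The current and its velocity *)

Section current.
Context {R : realType}.
Implicit Types t s : R.

Lemma measurable_kern_shift t x : measurable_fun setT (fun s => kern (x - pos t s)).
Proof.
apply: (measurableT_comp (continuous_measurable_fun (@continuous_kern R))).
by apply: measurable_funB => //; exact: measurable_pos1.
Qed.

Lemma kern_shift_bound t x s : `|kern (x - pos t s)| <= kern x.
Proof. by rewrite ger0_norm ?kern_ge0// kern_le// gerBl pos_ge0. Qed.

Definition vel t x : R := Rintegral unif setT (fun s => kern (x - pos t s)).

(** Every particle has speed at most 2, and averaging over the labels keeps the modulus of
    continuity of [kern]. *)
Lemma vel_holder t t' x x' :
  `|vel t x - vel t' x'| <= 4 * Num.sqrt (`|x - x'| + 2 * `|t - t'|).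
Proof.
have ik t0 x0 := prob_integrable unif (measurable_kern_shift t0 x0) (kern_shift_bound t0 x0).
rewrite /vel -RintegralB//.
apply: prob_Rintegral_bound => [|s].
  by apply: measurable_funB; exact: measurable_kern_shift.
apply: le_trans (kern_holder _ _) _; rewrite ler_pM2l// ler_wsqrtr//.
rewrite (_ : _ - _ - _ = (x - x') - (pos t s - pos t' s)); last by ring.
by apply: le_trans (ler_normB _ _) _; rewrite lerD2l pos_lipschitz.
Qed.

Lemma continuous_vel : continuous (fun q : R * R => vel q.1 q.2).
Proof.
move=> [t x]; apply/cvgrPdist_le => e e0.
(* With both distances below this bound, [|x - x'| + 2 * |t - t'|] is at most [(e / 4) ^ 2], and
   [vel_holder] gives [e]. *)
have e4 : 0 < (e / 4) ^+ 2 / 3 by rewrite divr_gt0 ?exprn_gt0// divr_gt0.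
have cf : fst q @[q --> (t, x)] --> t by exact: cvg_fst.
have cs : snd q @[q --> (t, x)] --> x by exact: cvg_snd.
move/cvgrPdist_le : cf => /(_ _ e4) cf; move/cvgrPdist_le : cs => /(_ _ e4) cs.
near=> q; apply: le_trans (vel_holder _ _ _ _) _.
rewrite mulrC -ler_pdivlMr//.
have -> : e / 4 = Num.sqrt ((e / 4) ^+ 2).
  by rewrite sqrtr_sqr ger0_norm// ltW// divr_gt0.
apply: ler_wsqrtr.
have : `|t - q.1| <= (e / 4) ^+ 2 / 3.
  by near: q; exact: cf.
have : `|x - q.2| <= (e / 4) ^+ 2 / 3 by near: q; exact: cs.
by move=> /=; lra.
Unshelve. all: by end_near. Qed.

(** The mass of the particles that rest at the origin. *)
Lemma unif_gt_half : Rintegral unif setT (\1_(`]2^-1, +oo[%classic) : R -> R) = 2^-1.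
Proof.
rewrite (_ : Rintegral _ _ _ = fine (unif `]2^-1, +oo[%classic)); last first.
  by rewrite /Rintegral integral_indic// setIT.
rewrite unif_itv//.
rewrite (_ : _ `&` _ = `]2^-1, 1]%classic); last first.
  by apply/seteqP; split=> y; rewrite /= !in_itv/= ?andbT; lra.
by rewrite lebesgue_measure_itv/= lte_fin ifT; [rewrite -EFinB/=; lra|lra].
Qed.

(* Moving particles are at distance at most 1 from each other, where [kern] vanishes,
   so only the mass 1/2 resting at the origin pushes them. *)
Lemma vel_pos t s : vel t (pos t s) = 2 * lag t s.
Proof.
have [s1|s1] := leP (2 * s) 1; last first.
  (* A resting particle is at 0 and all positions are nonnegative, so [kern] is evaluated at
     nonpositive points only. *)
  rewrite lag_eq0// mulr0 /vel.
  rewrite (@eq_Rintegral _ _ _ unif setT (fun=> 0)) ?prob_Rintegral_cst// => s' _.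
  rewrite kern_eq0// {1}/pos (lt_geF s1) lag_eq0// expr0n/= addr0 sub0r.
  by rewrite lerNl (le_trans _ (pos_ge0 _ _))// lerN10.
rewrite /vel (@eq_Rintegral _ _ _ unif setT (fun s' => (4 * lag t s) * \1_(`]2^-1, +oo[%classic) s')); last first.
  move=> s' _; rewrite indicE {1}/pos s1.
  have [s1'|s1'] := leP (2 * s') 1.
    rewrite memNset ?mulr0; last by rewrite /= in_itv/= andbT; lra.
    rewrite kern_eq0// /pos s1'.
    have := lag_ge0 t s; have := lag_le1 t s; have := lag_ge0 t s'; have := lag_le1 t s'.
    by nra.
  rewrite mem_set ?mulr1; last by rewrite /= in_itv/= andbT; lra.
  rewrite {1}/pos (lt_geF s1') (lag_eq0 t s1') expr0n/= addr0 subr0 /kern.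
  by rewrite addrAC subrr add0r sqrtr_sqr ger0_norm// lag_ge0.
rewrite RintegralZl//; last first.
  apply: (@prob_integrable _ _ _ _ _ 1) => [|y]; first exact: measurable_indic.
  by rewrite indicE; case: (_ \in _); rewrite ?normr1 ?normr0.
by rewrite unif_gt_half; lra.
Qed.

Definition unif2 : probability (R * R)%type R :=
  (@unif R \x @unif R)%E.

Definition zero3 : {measure set @R3 R -> \bar R} := mzero.

Definition curr3 t : {measure set @R3 R -> \bar R} := distribution unif2 (flow t).

Definition curr t (j : 'I_3) : {measure set @R3 R -> \bar R} :=
  if val j == 2%N then curr3 t else zero3.

Definition none (j : 'I_3) : {measure set @R3 R -> \bar R} := zero3.

Definition source z t : {measure set @R3 R -> \bar R} := distribution unif (edge z t).

(** The column index is fixed to the only component that the current has. The first row reads the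
    second variable and the second row the first, which makes the velocity divergence free. *)
Definition K3 (i j : 'I_3) (x : @R3 R) : R :=
  if val j == 2%N then
    match val i with 0%N => kern x.1.2 | 1%N => kern x.1.1 | _ => 0 end
  else 0.

Lemma Rintegral_zero3 (f : @R3 R -> R) : Rintegral zero3 setT f = 0.
Proof. by rewrite /Rintegral integral_measure_zero. Qed.

Section distribution_integral.
Context d (T : measurableType d) (P : probability T R) (X : {mfun T >-> @R3 R}).
Context (f : @R3 R -> R) (C : R).
Hypotheses (mf : measurable_fun setT f) (bf : forall w, `|f (X w)| <= C).

Lemma distribution_integrable : (distribution P X).-integrable setT (EFin \o f).
Proof.
apply: integrable_pushforward => //; first exact/measurable_EFinP.
rewrite preimage_setT; apply: (@prob_integrable _ _ _ P (f \o X) C) => //.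
exact: measurableT_comp.
Qed.

Lemma distribution_Rintegral :
  Rintegral (distribution P X) setT f = Rintegral P setT (fun w => f (X w)).
Proof.
rewrite /Rintegral integral_distribution//; first exact/measurable_EFinP.
by apply: (@prob_integrable _ _ _ P (f \o X) C) => //; exact: measurableT_comp.
Qed.

End distribution_integral.

Definition o0 : 'I_3 := @Ordinal 3 0 isT.
Definition o1 : 'I_3 := @Ordinal 3 1 isT.
Definition o2 : 'I_3 := @Ordinal 3 2 isT.

Lemma sum_ord3 (V : nmodType) (F : 'I_3 -> V) : \sum_(j < 3) F j = F o0 + F o1 + F o2.
Proof.
rewrite !big_ord_recl big_ord0 addr0 addrA.
by congr (F _ + F _ + F _); exact: val_inj.
Qed.

Lemma vint_curr t (phi : @R3 R -> @R3 R) C :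
  measurable_fun setT (fun x => coord o2 (phi x)) ->
  (forall p, `|coord o2 (phi (flow t p))| <= C) ->
  vint (curr t) none phi = Rintegral unif2 setT (fun p => coord o2 (phi (flow t p))).
Proof.
move=> mphi bphi; rewrite /vint sum_ord3 /sint /curr/= !Rintegral_zero3 !subr0 !add0r.
by rewrite (@distribution_Rintegral _ _ unif2 (flow t) (fun x => coord o2 (phi x)) C mphi bphi).
Qed.

Lemma velocity_curr t (x : @R3 R) :
  velocity K3 curr (fun=> none) t x = ((vel t x.1.2, vel t x.1.1), 0).
Proof.
have kE (y : R) (g : @R3 R -> R) : continuous g -> (forall p, g (flow t p) = pos t p.1) ->
    Rintegral (curr t o2) setT (fun z => kern (y - g z)) = vel t y.
  move=> cg gE; rewrite /curr/= (@distribution_Rintegral _ _ unif2 (flow t) _ (kern y)).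
  - under eq_Rintegral do rewrite gE.
    by rewrite (@prob_Rintegral_fst _ _ _ _ _ unif unif _ _ (measurable_kern_shift t y)
      (kern_shift_bound t y)).
  - apply: continuous_measurable_R3 => z; apply: (@continuous_comp _ _ _ (fun z => y - g z) kern).
      by apply: cvgB; [exact: cvg_cst|exact: cg].
    exact: continuous_kern.
  - by move=> p; rewrite gE kern_shift_bound.
rewrite /velocity /vec3 !sum_ord3 /sint.
rewrite /K3/= !Rintegral_cst//= !mul0r /none.
rewrite !Rintegral_zero3 !subr0 !add0r.
by rewrite (kE _ (fun z => z.1.1))//; [rewrite (kE _ (fun z => z.1.2))//|];
  move=> z; (apply: continuous_comp; first exact: cvg_fst);
  [exact: cvg_snd|exact: cvg_fst].
Qed.

End current.

(** * Calculus along the flow *)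

Section calculus.
Context {R : realType}.

(** The derivative is asked for only inside the interval: [clamp] stops the particles at time 1,
    where [pos] may fail to be differentiable. *)
Lemma FTC_unit (F f : R -> R) : continuous F -> continuous f ->
  (forall t : R, 0 < t < 1 -> is_derive t 1 F (f t)) ->
  Rintegral lebesgue_measure `[0, 1] f = F 1 - F 0.
Proof.
move=> cF cf dF; rewrite /Rintegral (@continuous_FTC2 _ f F 0 1)//.
- exact: continuous_subspaceT.
- split; first by move=> x; rewrite in_itv/= => /dF[].
  + exact/cvg_at_right_filter/cF.
  + exact/cvg_at_left_filter/cF.
- by move=> x; rewrite in_itv/= derive1E => /dF xF; rewrite derive_val.
Qed.

(** Meant for [pos] at the departure time, where [lag] has a kink but its square still has a
    quadratic remainder. *)
Lemma is_derive_quadratic (h : R -> R) (t d : R) :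
  (\forall y \near t, `|h y - h t - d * (y - t)| <= (y - t) ^+ 2) ->
  is_derive t 1 h d.
Proof.
move=> hd.
have cd : (fun e => e^-1 *: (h (e *: 1 + t) - h t)) @ 0^' --> d.
  apply/cvgrPdist_le => e e0.
  have {}hd : \forall y \near (0 : R)^', `|h (y + t) - h t - d * y| <= y ^+ 2.
    have : \forall y \near (0 : R), `|h (y + t) - h t - d * y| <= y ^+ 2.
      move: hd => /nbhs_ballP[r /= r0 hr]; apply/nbhs_ballP; exists r => //= y.
      rewrite /ball/= sub0r normrN => yr; have := hr (y + t).
      by rewrite /ball/= opprD addrCA subrr addr0 normrN addrK; exact.
    by move=> H; apply: nbhs_dnbhs H.
  near=> y.
  have y0 : y != 0 by near: y; exact: nbhs_dnbhs_neq.
  have -> : d - y^-1 *: (h (y *: 1 + t) - h t) =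
      - (y^-1 * (h (y + t) - h t - d * y)).
    by rewrite /GRing.scale/= mulr1; field.
  rewrite normrN normrM normfV.
  apply: (@le_trans _ _ (`|y|^-1 * y ^+ 2)).
    by rewrite ler_pM2l ?invr_gt0 ?normr_gt0//; near: y.
  rewrite -real_normK ?num_real// expr2 mulKf ?normr_eq0//.
  by near: y; apply: dnbhs0_le.
split; first by apply/cvg_ex; exists d.
exact/cvg_lim.
Unshelve. all: by end_near. Qed.

Lemma is_derive_pair (U V : normedModType R) (f : R -> U) (g : R -> V) (t : R) df dg :
  is_derive t 1 f df -> is_derive t 1 g dg ->
  is_derive t 1 (fun s => (f s, g s)) (df, dg).
Proof.
move=> [/derivable1_diffP ff fE] [/derivable1_diffP gg gE].
have fg : differentiable (fun s => (f s, g s)) t by exact: differentiable_pair.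
split; first exact: diff_derivable.
by rewrite deriveE// diff_pair// -fE -gE !deriveE.
Qed.

Lemma is_derive_comp_path (V : normedModType R) (f : V -> R) (g : R -> V) (t : R) v :
  differentiable f (g t) -> is_derive t 1 g v ->
  is_derive t 1 (fun s => f (g s)) ('D_v f (g t)).
Proof.
move=> df [/derivable1_diffP dg <-].
have dfg : differentiable (f \o g) t by exact: differentiable_comp.
split; first exact: (@diff_derivable _ _ _ (f \o g)).
by rewrite -[LHS]/('D_1 (f \o g) t) deriveE// diff_comp//= [in RHS]deriveE// [in RHS]deriveE.
Qed.

Lemma continuous_coord i : continuous (@Defs.coord R i).
Proof.
case: i => [[|[|i]] ?] x; rewrite /coord/=; last exact: cvg_snd.
all: apply: continuous_comp; first exact: cvg_fst.
- exact: cvg_fst.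
- exact: cvg_snd.
Qed.

Lemma coord_linear i : linear (@Defs.coord R i).
Proof. by case: i => [[|[|i]] ?] a x y. Qed.

HB.instance Definition _ i :=
  GRing.isLinear.Build R (@R3 R) R _ (@Defs.coord R i) (coord_linear i).

Lemma differentiable_coord3 (V : normedModType R) i (f : V -> @R3 R) x :
  differentiable f x -> differentiable (fun y => coord i (f y)) x.
Proof.
move=> df; apply: (@differentiable_comp _ _ _ _ f (@Defs.coord R i)) => //.
exact/linear_differentiable/continuous_coord.
Qed.

Lemma derive_coord (V : normedModType R) i (f : V -> @R3 R) x v :
  differentiable f x -> 'D_v (fun y => coord i (f y)) x = coord i ('D_v f x).
Proof.
move=> df; rewrite deriveE; last exact: differentiable_coord3.
rewrite (@diff_comp _ _ _ _ f (@Defs.coord R i))//=; last first.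
  exact/linear_differentiable/continuous_coord.
by rewrite diff_lin ?deriveE//; exact: continuous_coord.
Qed.

Lemma smooth_differentiable (V W : normedModType R) (f : V -> W) x :
  smooth f -> differentiable f x.
Proof. by move=> /(_ [::] x). Qed.

Lemma smooth_continuous (V W : normedModType R) (f : V -> W) :
  smooth f -> continuous f.
Proof. by move=> sf x; exact/differentiable_continuous/smooth_differentiable. Qed.

Lemma smooth_continuous_derive (V W : normedModType R) (f : V -> W) v :
  smooth f -> continuous ('D_v f).
Proof. by move=> sf x; apply: differentiable_continuous; exact: (sf [:: v] x). Qed.

End calculus.

Section path.
Context {R : realType}.

Lemma lipschitz_continuous (f : R -> R) (C : R) :
  (forall x y, `|f x - f y| <= C * `|x - y|) -> continuous f.
Proof.
move=> fC x; apply/cvgrPdist_le => e e0.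
have C0 : 0 < `|C| + 1 by rewrite ltr_pwDr.
near=> y; apply: le_trans (fC x y) _.
apply: (@le_trans _ _ ((`|C| + 1) * `|x - y|)).
  by rewrite ler_wpM2r// (le_trans (ler_norm _))// lerDl.
rewrite mulrC -ler_pdivlMr//.
by near: y; apply: cvgr_dist_le; [exact: cvg_id|rewrite divr_gt0].
Unshelve. all: by end_near. Qed.

Lemma continuous_pos s : continuous (fun t : R => pos t s).
Proof. by apply: (@lipschitz_continuous _ 2) => x y; rewrite pos_lipschitz. Qed.

Lemma continuous_pair (T : topologicalType) (U V : topologicalType)
    (f : T -> U) (g : T -> V) :
  continuous f -> continuous g -> continuous (fun t => (f t, g t)).
Proof. by move=> cf cg t; apply: cvg_pair; [exact: cf|exact: cg]. Qed.

Lemma continuous_flow p : continuous (fun t : R => flow t p).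
Proof.
apply: continuous_pair; last by move=> t; exact: cvg_cst.
by apply: continuous_pair; exact: continuous_pos.
Qed.

(** The remainder is 0 if both times precede the departure and [(y - t) ^ 2] if both follow it; when
    the departure falls between them it lies between these two values. *)
Lemma is_derive_pos (t s : R) : 0 < t < 1 ->
  is_derive t 1 (fun t => pos t s) (2 * lag t s).
Proof.
move=> /andP[t0 t1]; apply: is_derive_quadratic; near=> y.
have y0 : 0 < y by near: y; exact: lt_nbhsr.
have y1 : y < 1 by near: y; exact: lt_nbhsl.
rewrite /pos opprD addrACA subrr add0r /lag (@clamp_id R y) ?(@clamp_id R t); [|by apply/andP; split; lra..].
set a := 2 * clamp s; rewrite /Num.max.
have := sqr_ge0 (y - t); have := sqr_ge0 (y - a); have := sqr_ge0 (t - a).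
move=> h1 h2 h3; case: ltrP => ya; case: ltrP => ta; rewrite ler_norml; apply/andP; split.
all: try lra.
- have : 0 <= (a - t) * ((y - a) + (y - t)) by apply: mulr_ge0; lra.
  by lra.
- have : 0 <= (a - y) * ((t - y) + (t - a)) by apply: mulr_ge0; lra.
  have : 0 <= (t - a) * (t - y) by apply: mulr_ge0; lra.
  by lra.
Unshelve. all: by end_near. Qed.

Lemma is_derive_flow (t : R) p : 0 < t < 1 ->
  is_derive t 1 (fun t => flow t p)
    ((2 * lag t p.1) *: (ebasis o0 + ebasis o1)).
Proof.
move=> t01.
have -> : (2 * lag t p.1) *: (ebasis o0 + ebasis o1) =
    ((2 * lag t p.1, 2 * lag t p.1), 0) :> @R3 R.
  have scaleE (c y : R) : c *: y = c * y by [].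
  apply: injective_projections; first apply: injective_projections.
  - by change ((2 * lag t p.1) *: (1 + 0 : R) = 2 * lag t p.1); rewrite scaleE; ring.
  - by change ((2 * lag t p.1) *: (0 + 1 : R) = 2 * lag t p.1); rewrite scaleE; ring.
  - by change ((2 * lag t p.1) *: (0 + 0 : R) = 0); rewrite scaleE; ring.
apply: (@is_derive_pair R (R * R)%type R (fun t => (pos t p.1, pos t p.1))
  (fun=> clamp p.2)).
by apply: is_derive_pair; exact: is_derive_pos.
Qed.

End path.

(** * Weak advection *)

Section advection.
Context {R : realType}.

Lemma normr_le2 (x : R) : 0 <= x -> x <= 2 -> `|x| <= 2.
Proof. by move=> x0 x2; rewrite ger0_norm. Qed.

Lemma flow_bounds (t : R) p :
  [/\ `|(flow t p).1.1| <= 2, `|(flow t p).1.2| <= 2 & `|(flow t p).2| <= 2].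
Proof.
rewrite /flow/=; split; apply: normr_le2; rewrite ?pos_ge0 ?pos_le2 ?clamp_ge0//.
by apply: le_trans (clamp_le1 _) _; lra.
Qed.

Lemma edge_bounds (z t s : R) : 0 <= z <= 1 ->
  [/\ `|(edge z t s).1.1| <= 2, `|(edge z t s).1.2| <= 2 & `|(edge z t s).2| <= 2].
Proof.
move=> /andP[z0 z1].
by rewrite /edge/=; split; apply: normr_le2; rewrite ?pos_ge0 ?pos_le2//; lra.
Qed.

Lemma continuous_slice (A : R * @R3 R -> R) t : continuous A -> continuous (fun x => A (t, x)).
Proof.
move=> cA x; apply: (@continuous_comp _ _ _ (fun x => (t, x)) A); last exact: cA.
by apply: continuous_pair => ?; [exact: cvg_cst|exact: cvg_id].
Qed.

Lemma continuousMf (T : topologicalType) (f g : T -> R) :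
  continuous f -> continuous g -> continuous (fun x => f x * g x).
Proof. by move=> cf cg x; apply: cvgM; [exact: cf|exact: cg]. Qed.

Lemma continuousDf (T : topologicalType) (f g : T -> R) :
  continuous f -> continuous g -> continuous (fun x => f x + g x).
Proof. by move=> cf cg x; apply: cvgD; [exact: cf|exact: cg]. Qed.

(** All trajectories stay in the cube [[-2, 2]^3], so continuity alone bounds every integrand along
    the flow. *)
Lemma continuous_flow_bounded (f : @R3 R -> R) (t : R) : continuous f ->
  exists C, forall p, `|f (flow t p)| <= C.
Proof.
move=> /(@continuous_bounded_R3 _ _ 2)[C hC]; exists C => p.
by have [] := flow_bounds t p; exact: hC.
Qed.

Lemma continuous_edge_bounded (f : @R3 R -> R) (z t : R) : 0 <= z <= 1 -> continuous f ->
  exists C, forall s, `|f (edge z t s)| <= C.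
Proof.
move=> z01 /(@continuous_bounded_R3 _ _ 2)[C hC]; exists C => s.
by have [] := edge_bounds t s z01; exact: hC.
Qed.

Lemma source_Rintegral (f : @R3 R -> R) (z t : R) : 0 <= z <= 1 -> continuous f ->
  Rintegral (source z t) setT f = Rintegral unif setT (fun s => f (edge z t s)).
Proof.
move=> z01 cf; have [C hC] := continuous_edge_bounded t z01 cf.
exact: (@distribution_Rintegral _ _ _ unif (edge z t) f C
  (continuous_measurable_R3 cf) hC).
Qed.

Lemma vint_curr_continuous t (phi : @R3 R -> @R3 R) :
  continuous (fun x => coord o2 (phi x)) ->
  vint (curr t) none phi = Rintegral unif2 setT (fun p => coord o2 (phi (flow t p))).
Proof.
move=> cf; have [C hC] := continuous_flow_bounded t cf.
by apply: vint_curr hC; exact: continuous_measurable_R3.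
Qed.

(** The fundamental theorem on each vertical segment, averaged over the particles. Stating it for
    any [w] that is the vertical derivative of [g] lets it serve both the divergence, where [g] is a
    test function, and the stretching term, where [g] is [phi . u]. *)
Lemma curr_boundary t (g w : @R3 R -> R) : continuous g -> continuous w ->
  (forall a b z : R, is_derive z 1 (fun z => g ((a, b), z)) (w ((a, b), z))) ->
  Rintegral unif2 setT (fun p => w (flow t p)) =
  Rintegral (source 1 t) setT g - Rintegral (source 0 t) setT g.
Proof.
move=> cg cw dg.
have [C hC] := continuous_flow_bounded t cw.
have mw : measurable_fun setT (fun p => w (flow t p)).
  by apply: measurableT_comp; [exact: continuous_measurable_R3|exact: measurable_flow].
have i0 : 0 <= (0 : R) <= 1 by rewrite lexx ler01.
have i1 : 0 <= (1 : R) <= 1 by rewrite lexx ler01.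
have [C0 hC0] := continuous_edge_bounded t i0 cg.
have [C1 hC1] := continuous_edge_bounded t i1 cg.
have me z : measurable_fun setT (fun s => g (edge z t s)).
  by apply: measurableT_comp; [exact: continuous_measurable_R3|exact: measurable_edge].
rewrite !source_Rintegral// -RintegralB//; [|exact: prob_integrable hC1|exact: prob_integrable hC0].
rewrite /unif2 (prob_Rintegral12 unif unif mw hC); apply: eq_Rintegral => s _.
rewrite (@unif_Rintegral _ (fun z => w (flow t (s, z))) C) => [|//|]; last 2 first.
- by apply: (measurableT_comp mw); exact: pair1_measurable.
- by move=> z; exact: hC.
have cz (f : @R3 R -> R) : continuous f -> continuous (fun z => f ((pos t s, pos t s), z)).
  move=> cf z; apply: (@continuous_comp _ _ _ (fun z => ((pos t s, pos t s), z)) f);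
    last exact: cf.
  by apply: continuous_pair => ?; [exact: cvg_cst|exact: cvg_id].
rewrite -(@FTC_unit _ (fun z => g ((pos t s, pos t s), z))
    (fun z => w ((pos t s, pos t s), z)))//; [|exact: cz..].
apply: eq_Rintegral => z; rewrite inE /= in_itv/= => z01.
by rewrite /flow/= clamp_id.
Qed.

Lemma is_derive_slice (psi : @R3 R -> R) (a b z : R) : smooth psi ->
  is_derive z 1 (fun z => psi ((a, b), z)) ('D_(ebasis o2) psi ((a, b), z)).
Proof.
move=> sp; have dp : differentiable psi ((a, b), z) by exact: smooth_differentiable.
have dpath : is_derive z (1 : R) (fun z : R => ((a, b), z)) (ebasis o2).
  exact: (@is_derive_pair R (R * R)%type R (fun=> (a, b)) id).
exact: (is_derive_comp_path dp dpath).
Qed.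

(** The minus sign in [is_divergence] makes the feet of the segments the positive part of the
    divergence and their tops the negative part. *)
Lemma divergence_curr (t : R) : is_divergence (curr t) none (source 0 t) (source 1 t).
Proof.
move=> psi [sp _]; have cp := smooth_continuous sp.
have cdp : continuous (fun x : @R3 R => 'D_(ebasis o2) psi x).
  exact: smooth_continuous_derive.
rewrite vint_curr_continuous//.
rewrite (curr_boundary t cp cdp (fun a b z => is_derive_slice a b z sp)).
by rewrite /sint opprB.
Qed.

Section time_slices.
Context {A : R * @R3 R -> R} (cA : continuous A).
Let F t := Rintegral unif2 setT (fun p => A (t, flow t p)).

(** With the time clamped the integrand is bounded for all real times, as Fubini for probabilities
    requires; on [[0, 1]] nothing changes. *)
Let f (q : R * (R * R)) := A (clamp q.1, flow q.1 q.2).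

Let mf : measurable_fun setT f.
Proof.
apply: (measurableT_comp (continuous_measurable_RR3 cA)
  (_ : measurable_fun setT (fun q : R * (R * R) => (clamp q.1, flow q.1 q.2)))).
apply: measurable_fun_pair; last exact: measurable_flow2.
exact: (measurableT_comp measurable_clamp).
Qed.

Let bf : exists C, forall q, `|f q| <= C.
Proof.
have [C hC] := @continuous_bounded_RR3 _ _ 2 cA; exists C => q.
have [] := flow_bounds q.1 q.2; apply: hC.
by apply: normr_le2; rewrite ?clamp_ge0//; apply: le_trans (clamp_le1 _) _; lra.
Qed.

Let FE t : 0 <= t <= 1 -> F t = Rintegral unif2 setT (fun p => f (t, p)).
Proof. by move=> t01; rewrite /F /f/= clamp_id. Qed.

Lemma integrable_time_slices : lebesgue_measure.-integrable `[0, 1] (EFin \o F).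
Proof.
have [C hC] := bf.
have mF := measurable_prob_Rintegral1 unif unif2 mf hC.
apply: (@eq_integrable _ _ _ lebesgue_measure _ _
    (EFin \o (fun t => Rintegral unif2 setT (fun p => f (t, p))))) => //.
  by move=> t; rewrite inE /= in_itv/= => t01; rewrite FE.
apply: (@bounded_measurable_integrable _ _ _ _ _ _ C) => //.
- have : (@lebesgue_measure R `[0%R, 1%R]%classic < +oo)%E.
    by rewrite lebesgue_measure_itv/= lte_fin ltr01 ltry.
  exact.
- exact: measurable_funTS.
- move=> t _; apply: prob_Rintegral_bound => //; apply: (measurableT_comp mf).
  exact: pair1_measurable.
Qed.

(** Lebesgue measure on [[0, 1]] is replaced by [unif], so that Fubini is applied to two
    probabilities, and is restored afterwards. *)
Lemma Rintegral_time_slices : Rintegral lebesgue_measure `[0, 1] F =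
  Rintegral unif2 setT (fun p => Rintegral lebesgue_measure `[0, 1] (fun t => A (t, flow t p))).
Proof.
have [C hC] := bf.
have mF := measurable_prob_Rintegral1 unif unif2 mf hC.
transitivity (Rintegral lebesgue_measure `[0, 1]
    (fun t => Rintegral unif2 setT (fun p => f (t, p)))).
  by apply: eq_Rintegral => t; rewrite inE /= in_itv/= => t01; exact: FE.
rewrite -(@unif_Rintegral _ _ C)//; last first.
  move=> t; apply: prob_Rintegral_bound => //; apply: (measurableT_comp mf).
  exact: pair1_measurable.
rewrite -(prob_Rintegral12 unif unif2 mf hC) (prob_Rintegral21 unif unif2 mf hC).
apply: eq_Rintegral => p _.
rewrite (@unif_Rintegral _ (fun t => f (t, p)) C) => [|//|]; last 2 first.
- by apply: (measurableT_comp mf); exact: pair2_measurable.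
- by move=> t; exact: hC.
by apply: eq_Rintegral => t; rewrite inE /= in_itv/= /f/= => /clamp_id ->.
Qed.

End time_slices.

End advection.

Section weak_advection.
Context {R : realType}.

Definition U3 (t : R) (x : @R3 R) : @R3 R := ((vel t x.1.2, vel t x.1.1), 0).

Lemma velocityE : velocity (@K3 R) curr (fun=> none) = U3.
Proof. by apply/funext => t; apply/funext => x; exact: velocity_curr. Qed.

Lemma continuous_vel_coord (g : @R3 R -> R) : continuous g ->
  continuous (fun q : R * @R3 R => vel q.1 (g q.2)).
Proof.
move=> cg q; apply: (@continuous_comp _ _ _ (fun q => (q.1, g q.2))
  (fun q : R * R => vel q.1 q.2)); last exact: continuous_vel.
apply: continuous_pair; first by move=> z; exact: cvg_fst.
by move=> z; apply: continuous_comp; [exact: cvg_snd|exact: cg].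
Qed.

Lemma continuous_vel1 : continuous (fun q : R * @R3 R => vel q.1 q.2.1.1).
Proof.
apply: (continuous_vel_coord (g := fun x => x.1.1)) => x.
by apply: continuous_comp; exact: cvg_fst.
Qed.

Lemma continuous_vel2 : continuous (fun q : R * @R3 R => vel q.1 q.2.1.2).
Proof.
apply: (continuous_vel_coord (g := fun x => x.1.2)) => x.
by apply: continuous_comp; [exact: cvg_fst|exact: cvg_snd].
Qed.

Lemma continuous_U3 : continuous (fun q : R * @R3 R => U3 q.1 q.2).
Proof.
apply: continuous_pair; last by move=> ?; exact: cvg_cst.
by apply: continuous_pair; [exact: continuous_vel2|exact: continuous_vel1].
Qed.

Lemma continuous_coordf (T : topologicalType) j (f : T -> @R3 R) : continuous f ->
  continuous (fun x => coord j (f x)).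
Proof. by move=> cf x; apply: continuous_comp; [exact: cf|exact: continuous_coord]. Qed.

Section test.
Context {phi : R * @R3 R -> @R3 R} (sphi : smooth phi).

Lemma continuous_dt j : continuous (fun q => coord j (dt phi q.1 q.2)).
Proof.
apply: continuous_coordf.
rewrite (_ : (fun q => dt phi q.1 q.2) = 'D_((1, 0) : R * @R3 R) phi); last first.
  by apply/funext => -[t x].
exact: smooth_continuous_derive.
Qed.

Lemma continuous_dx i j : continuous (fun q => coord j (dx i phi q.1 q.2)).
Proof.
apply: continuous_coordf.
rewrite (_ : (fun q => dx i phi q.1 q.2) = 'D_((0, ebasis i) : R * @R3 R) phi); last first.
  by apply/funext => -[t x].
exact: smooth_continuous_derive.
Qed.

Lemma adv_termE t x j : coord j (adv_term U3 phi t x) =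
  vel t x.1.2 * coord j (dx o0 phi t x) + vel t x.1.1 * coord j (dx o1 phi t x).
Proof.
by case: j => -[|[|[|//]]] ?; rewrite /coord/= sum_ord3/= mul0r addr0.
Qed.

Lemma str_termE t x : coord o2 (str_term U3 phi t x) =
  vel t x.1.2 * coord o0 (dx o2 phi t x) + vel t x.1.1 * coord o1 (dx o2 phi t x).
Proof.
by rewrite /coord/= sum_ord3/= mulr0 addr0 ![_ * vel _ _]mulrC.
Qed.

Lemma dot_U3 t x : dot (phi (t, x)) (U3 t x) =
  vel t x.1.2 * coord o0 (phi (t, x)) + vel t x.1.1 * coord o1 (phi (t, x)).
Proof.
by rewrite /dot sum_ord3 /coord/= mulr0 addr0 ![_ * vel _ _]mulrC.
Qed.

Lemma continuous_adv : continuous (fun q => coord o2 (adv_term U3 phi q.1 q.2)).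
Proof.
rewrite (_ : (fun _ => _) = fun q => vel q.1 q.2.1.2 * coord o2 (dx o0 phi q.1 q.2) +
    vel q.1 q.2.1.1 * coord o2 (dx o1 phi q.1 q.2)); last first.
  by apply/funext => q; rewrite adv_termE.
by apply: continuousDf; apply: continuousMf; [exact: continuous_vel2|
  exact: continuous_dx|exact: continuous_vel1|exact: continuous_dx].
Qed.

Lemma continuous_str : continuous (fun q => coord o2 (str_term U3 phi q.1 q.2)).
Proof.
rewrite (_ : (fun _ => _) = fun q => vel q.1 q.2.1.2 * coord o0 (dx o2 phi q.1 q.2) +
    vel q.1 q.2.1.1 * coord o1 (dx o2 phi q.1 q.2)); last first.
  by apply/funext => q; rewrite str_termE.
by apply: continuousDf; apply: continuousMf; [exact: continuous_vel2|
  exact: continuous_dx|exact: continuous_vel1|exact: continuous_dx].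
Qed.

Lemma continuous_dotU : continuous (fun q => dot (phi q) (U3 q.1 q.2)).
Proof.
rewrite (_ : (fun _ => _) = fun q => vel q.1 q.2.1.2 * coord o0 (phi q) +
    vel q.1 q.2.1.1 * coord o1 (phi q)); last first.
  by apply/funext => -[t x]; rewrite dot_U3.
by apply: continuousDf; apply: continuousMf; [exact: continuous_vel2|
  exact: (continuous_coordf (smooth_continuous sphi))|exact: continuous_vel1|
  exact: (continuous_coordf (smooth_continuous sphi))].
Qed.

(** As the velocity does not depend on the height, the third component of [str_term] is the vertical
    derivative of [phi . u], whose integral along a segment is a difference of end values. *)
Lemma stretching_balance (t : R) :
  sint (source 0 t) (source 1 t) (fun x => dot (phi (t, x)) (U3 t x)) =
  - vint (curr t) none (str_term U3 phi t).
Proof.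
have cg := continuous_slice (t := t) continuous_dotU.
have cw := continuous_slice (t := t) continuous_str.
have dg (a b z : R) : is_derive z (1 : R)
    (fun z => dot (phi (t, ((a, b), z))) (U3 t ((a, b), z)))
    (coord o2 (str_term U3 phi t ((a, b), z))).
  rewrite (_ : (fun _ => _) = fun z => vel t b * coord o0 (phi (t, ((a, b), z))) +
      vel t a * coord o1 (phi (t, ((a, b), z)))); last first.
    by apply/funext => y; rewrite dot_U3.
  rewrite str_termE/=.
  have dpath : is_derive z (1 : R) (fun z : R => (t, ((a, b), z))) (0, ebasis o2).
    apply: (@is_derive_pair R R (@R3 R) (fun=> t) (fun z => ((a, b), z))).
    exact: (@is_derive_pair R (R * R)%type R (fun=> (a, b)) id).
  have dj j : is_derive z (1 : R) (fun z => coord j (phi (t, ((a, b), z))))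
      (coord j (dx o2 phi t ((a, b), z))).
    have dphi := smooth_differentiable (t, ((a, b), z)) sphi.
    have := is_derive_comp_path (differentiable_coord3 j dphi) dpath.
    by rewrite derive_coord.
  by apply: is_deriveD; exact: is_deriveZ.
have := curr_boundary t cg cw dg.
rewrite vint_curr_continuous//= => ->.
by rewrite /sint opprB.
Qed.

(** By [vel_pos] both horizontal components of the field at [flow t p] equal the speed of the
    particle, so the chain rule along its trajectory yields the transport terms. *)
Lemma is_derive_transport (t : R) p : 0 < t < 1 ->
  is_derive t 1 (fun t => coord o2 (phi (t, flow t p)))
    (coord o2 (dt phi t (flow t p)) + coord o2 (adv_term U3 phi t (flow t p))).
Proof.
move=> t01; have dphi := smooth_differentiable (t, flow t p) sphi.
have dpath : is_derive t (1 : R) (fun t => (t, flow t p))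
    (1, (2 * lag t p.1) *: (ebasis o0 + ebasis o1)).
  apply: is_derive_pair; exact: is_derive_flow.
have := is_derive_comp_path (differentiable_coord3 o2 dphi) dpath.
rewrite derive_coord// adv_termE {1 2}/flow/= vel_pos -mulrDr.
suff -> : 'D_(1, (2 * lag t p.1) *: (ebasis o0 + ebasis o1)) phi (t, flow t p) =
    dt phi t (flow t p) + (2 * lag t p.1) *:
      (dx o0 phi t (flow t p) + dx o1 phi t (flow t p)).
  by [].
rewrite /dt /dx !deriveE// -linearD -linearZ -linearD; congr ('d _ _ _).
apply: injective_projections.
  by change ((1 : R) = 1 + (2 * lag t p.1) *: (0 + 0 : R)); rewrite addr0 scaler0 addr0.
by change ((2 * lag t p.1) *: (ebasis o0 + ebasis o1) =
  0 + (2 * lag t p.1) *: (ebasis o0 + ebasis o1) :> @R3 R); rewrite add0r.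
Qed.

(** Exchanging the integrals puts time innermost; on each trajectory the integrand is then a total
    derivative. *)
Lemma transport_balance :
  Rintegral lebesgue_measure `[0, 1] (fun t => vint (curr t) none (dt phi t))
  + Rintegral lebesgue_measure `[0, 1] (fun t => vint (curr t) none (adv_term U3 phi t))
  = vint (curr 1) none (fun x => phi (1, x)) - vint (curr 0) none (fun x => phi (0, x)).
Proof.
have cphi := smooth_continuous sphi.
have cdt := continuous_dt (j := o2); have cadv := continuous_adv.
have c2 : continuous (fun q => coord o2 (phi q)) by exact: continuous_coordf.
pose A q := coord o2 (dt phi q.1 q.2) + coord o2 (adv_term U3 phi q.1 q.2).
have cA : continuous A by exact: continuousDf cdt cadv.
have slice (f : R * @R3 R -> R) (t : R) : continuous f ->
    exists C, forall p, `|f (t, flow t p)| <= C.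
  by move=> cf; exact: (continuous_flow_bounded t (continuous_slice (t := t) cf)).
have mslice (f : R * @R3 R -> R) (t : R) : continuous f ->
    measurable_fun setT (fun p => f (t, flow t p)).
  move=> cf; apply: (measurableT_comp
    (continuous_measurable_R3 (continuous_slice (t := t) cf))).
  exact: measurable_flow.
have islice (f : R * @R3 R -> R) (t : R) : continuous f ->
    unif2.-integrable setT (EFin \o (fun p => f (t, flow t p))).
  move=> cf; have [C hC] := slice f t cf.
  exact: prob_integrable (mslice f t cf) hC.
rewrite -RintegralD//; last 2 first.
- rewrite (_ : (fun _ => _) = fun t => Rintegral unif2 setT
      (fun p => coord o2 (dt phi t (flow t p)))); last first.
    by apply/funext => t; rewrite vint_curr_continuous//;
      exact: (continuous_slice (t := t) cdt).
  exact: (integrable_time_slices cdt).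
- rewrite (_ : (fun _ => _) = fun t => Rintegral unif2 setT
      (fun p => coord o2 (adv_term U3 phi t (flow t p)))); last first.
    by apply/funext => t; rewrite vint_curr_continuous//;
      exact: (continuous_slice (t := t) cadv).
  exact: (integrable_time_slices cadv).
transitivity (Rintegral lebesgue_measure `[0, 1]
    (fun t => Rintegral unif2 setT (fun p => A (t, flow t p)))).
  apply: eq_Rintegral => t _.
  rewrite vint_curr_continuous; last exact: (continuous_slice (t := t) cdt).
  rewrite vint_curr_continuous; last exact: (continuous_slice (t := t) cadv).
  by rewrite -RintegralD//; [exact: (islice _ t cdt)|exact: (islice _ t cadv)].
rewrite (Rintegral_time_slices cA).
rewrite !vint_curr_continuous; [|exact: (continuous_slice (t := 0) c2)|
  exact: (continuous_slice (t := 1) c2)].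
rewrite -RintegralB//; [|exact: (islice _ 1 c2)|exact: (islice _ 0 c2)].
apply: eq_Rintegral => p _.
have cpath (f : R * @R3 R -> R) : continuous f -> continuous (fun t => f (t, flow t p)).
  move=> cf t; apply: (@continuous_comp _ _ _ (fun t => (t, flow t p)) f); last exact: cf.
  by apply: continuous_pair; [by move=> ?; exact: cvg_id|exact: continuous_flow].
apply: (@FTC_unit _ (fun t => coord o2 (phi (t, flow t p)))).
- exact: cpath c2.
- exact: cpath cA.
- by move=> t t01; exact: is_derive_transport.
Qed.

End test.

Lemma curr_weakly_advected :
  weakly_advected 1 (velocity (@K3 R) curr (fun=> none)) curr (fun=> none)
    (source 0) (source 1).
Proof.
rewrite velocityE => phi [sphi _].
have iF (A : R * @R3 R -> R) (F : R -> R) : continuous A ->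
    (forall t, F t = Rintegral unif2 setT (fun p => A (t, flow t p))) ->
    lebesgue_measure.-integrable `[0, 1] (EFin \o F).
  by move=> cA FE; rewrite (funext FE); exact: integrable_time_slices.
have i3 : lebesgue_measure.-integrable `[0, 1]
    (EFin \o (fun t => vint (curr t) none (str_term U3 phi t))).
  apply: iF (continuous_str sphi) _ => t; rewrite vint_curr_continuous//.
  exact: (continuous_slice (t := t) (continuous_str sphi)).
(* The divergence term is minus the stretching term at every time, so [F3] and [F4] cancel and only
   the transport identity is left. *)
have F4E : (fun t : R => sint (source 0 t) (source 1 t)
    (fun x => dot (phi (t, x)) (U3 t x))) =
    fun t => - vint (curr t) none (str_term U3 phi t).
  by apply/funext => t; exact: stretching_balance.
move=> F1 F2 F3 F4; rewrite {}/F4 F4E; split.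
- apply: iF (continuous_dt sphi (j := o2)) _ => t; rewrite /F1 vint_curr_continuous//.
  exact: (continuous_slice (t := t) (continuous_dt sphi (j := o2))).
- apply: iF (continuous_adv sphi) _ => t; rewrite /F2 vint_curr_continuous//.
  exact: (continuous_slice (t := t) (continuous_adv sphi)).
- exact: i3.
- by rewrite (_ : EFin \o _ = \- (EFin \o F3))%E//; exact: integrableN.
- rewrite (_ : Rintegral _ _ (fun t => - _) = - Rintegral lebesgue_measure `[0, 1] F3).
    have := transport_balance sphi; rewrite -/F1 -/F2; lra.
  rewrite -mulN1r -RintegralZl//; apply: eq_Rintegral => t _.
  by rewrite mulN1r.
Qed.

End weak_advection.

(** * The velocity is divergence free *)

Section divergence_free.
Context {R : realType}.
Local Notation leb := (@lebesgue_measure R).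

(** The inner product of [leb3] gets a name in order to carry the sigma-finiteness that Fubini asks
    of each factor. *)
Definition leb2 : set (measurableTypeR R * measurableTypeR R) -> \bar R := (leb \x leb)%E.

HB.instance Definition _ := Measure.on leb2.

Lemma leb2_sigma_finite : sigma_finite setT leb2.
Proof.
pose I n : set (measurableTypeR R) := `[- n%:R, n%:R]%classic.
exists (fun n => I n `*` I n).
  apply/seteqP; split=> // -[x y] _; exists (Num.bound (`|x| + `|y|)) => //.
  have /ltW b : `|x| + `|y| < (Num.bound (`|x| + `|y|))%:R by rewrite archi_boundP// addr_ge0.
  have := normr_ge0 x; have := normr_ge0 y.
  by split; rewrite /I /= in_itv/= -ler_norml; lra.
move=> n; have mI : measurable (I n) by exact: measurable_itv.
have ltyI : (leb (I n) < +oo)%E.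
  by rewrite /I lebesgue_measure_itv/=; case: ifP => _; rewrite ?ltry// -EFinB ltry.
split; first exact: measurableX.
by rewrite /leb2 product_measure1E// lte_mul_pinfty// ge0_fin_numE.
Qed.

HB.instance Definition _ := @Measure_isSigmaFinite.Build _ _ _ leb2 leb2_sigma_finite.

Lemma integral_derivative_compact (h h' : R -> R) (r : R) : 0 < r ->
  continuous h' -> (forall x : R, is_derive x 1 h (h' x)) ->
  (forall x, r < `|x| -> h x = 0 /\ h' x = 0) ->
  (\int[leb]_x (h' x)%:E = 0)%E.
Proof.
move=> r0 ch' dh hr.
have ch : continuous h.
  by move=> x; apply: differentiable_continuous; apply/derivable1_diffP; have [] := dh x.
(* A point strictly beyond [r], since [h] is assumed to vanish only for [r < |x|]; both boundary
   values are then 0. *)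
pose a := r + 1.
transitivity (\int[leb]_(x in `[(- a)%R, a]) (h' x)%:E)%E.
  rewrite [RHS]integral_mkcond; apply: eq_integral => x _.
  rewrite patchE; case: ifPn => //; rewrite notin_setE /= in_itv/= -ler_norml => /negP.
  by rewrite -ltNge => ax; rewrite (hr x _).2//; apply: lt_trans ax; rewrite ltrDl.
have aa : - a < a by rewrite /a; lra.
have ha : r < `|a| by rewrite /a ger0_norm; lra.
rewrite (@continuous_FTC2 _ h' h)//.
- by rewrite (hr a ha).1 (hr (- a) _).1 ?normrN// subee.
- exact: continuous_subspaceT.
- split; first by move=> x _; have [] := dh x.
  + exact/cvg_at_right_filter/ch.
  + exact/cvg_at_left_filter/ch.
- by move=> x _; rewrite derive1E; have xh := dh x; rewrite derive_val.
Qed.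

Section box.
Context (w : @R3 R -> R) (r : R) (cw : continuous w).
Hypothesis wr : forall x, (r < `|x.1.1|) || (r < `|x.1.2|) || (r < `|x.2|) -> w x = 0.

Let seg : set R := `[- r, r]%classic.
Let box2 : set (R * R) := seg `*` seg.
Let box3 : set (@R3 R) := box2 `*` seg.

Let out3 x : ~ box3 x -> w x = 0.
Proof.
move=> nx; apply: wr; apply/negbNE/negP; rewrite !negb_or -!leNgt => /andP[/andP[h1 h2] h3].
by apply: nx; rewrite /box3 /box2 /seg /= !in_itv/= -!ler_norml.
Qed.

Let segment_lty : (leb seg < +oo)%E.
Proof. by rewrite /seg lebesgue_measure_itv/=; case: ifP => _; rewrite ?ltry// -EFinB ltry. Qed.

Let segment_fin : leb seg \is a fin_num.
Proof. by rewrite ge0_fin_numE. Qed.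

Let mseg : @measurable _ (measurableTypeR R) seg.
Proof. exact: measurable_itv. Qed.

Let mbox2 : @measurable _ (measurableTypeR R * measurableTypeR R)%type box2.
Proof. by apply: (@measurableX _ _ (measurableTypeR R) (measurableTypeR R)). Qed.

Let mbox3 : @measurable _
  (measurableTypeR R * measurableTypeR R * measurableTypeR R)%type box3.
Proof.
by apply: (@measurableX _ _ (measurableTypeR R * measurableTypeR R)%type
  (measurableTypeR R)).
Qed.

Lemma compact_leb3_integrable :
  (leb2 \x leb)%E.-integrable setT (fun x => (w x)%:E).
Proof.
have [C hC] := continuous_bounded_R3 r cw.
have -> : (fun x => (w x)%:E) = (EFin \o w) \_ box3.
  by apply/funext => x; rewrite patchE; case: ifPn => //; rewrite notin_setE => /out3 /= ->.
apply/(integrable_mkcond _ mbox3).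
apply: (@bounded_measurable_integrable R _ _ leb3 box3 w C) => //.
- suff : (leb3 box3 < +oo)%E by [].
  have -> : leb3 box3 = (leb seg * leb seg *
      leb seg)%E.
    rewrite /leb3 [LHS](product_measure1E leb2 leb mbox2 mseg).
    by congr (_ * _)%E; exact: (product_measure1E leb leb mseg mseg).
  by rewrite lte_mul_pinfty// ?mule_ge0// fin_numM.
- apply: measurable_funTS; exact: continuous_measurable_R3.
- move=> x [[]] /=; rewrite /seg /= !in_itv/= -!ler_norml => h1 h2 h3; exact: hC.
Qed.

Lemma compact_slice_integrable z :
  (leb \x leb)%E.-integrable setT (fun p => (w (p, z))%:E).
Proof.
have [C hC] := continuous_bounded_R3 `|r| cw.
have [rz|rz] := ltP r `|z|.
  rewrite (_ : (fun _ => _) = cst 0%E); first exact: integrable0.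
  by apply/funext => p; rewrite wr//= rz orbT.
have -> : (fun p => (w (p, z))%:E) = (fun p => (w (p, z))%:E) \_ box2.
  apply/funext => x; rewrite patchE; case: ifPn => //; rewrite notin_setE => nx.
  by rewrite out3// => -[].
apply/(integrable_mkcond _ mbox2).
apply: (@bounded_measurable_integrable R _ _ (leb \x leb)%E box2 (fun p => w (p, z)) C) => //.
- suff : ((leb \x leb)%E box2 < +oo)%E by [].
  have -> : (leb \x leb)%E box2 = (leb seg * leb seg)%E.
    exact: (product_measure1E leb leb mseg mseg).
  by rewrite lte_mul_pinfty.
- apply: measurable_funTS; apply: continuous_measurable_R2 => p.
  apply: (@continuous_comp _ _ _ (fun p => (p, z)) w); last exact: cw.
  by apply: continuous_pair => ?; [exact: cvg_id|exact: cvg_cst].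
- move=> x [] /=; rewrite /seg /= !in_itv/= -!ler_norml => h1 h2.
  by apply: hC; rewrite /= (le_trans _ (ler_norm r)).
Qed.

(** By Fubini it suffices that the integrals along one horizontal direction vanish; the two
    alternatives serve the two nonzero terms of [u . grad psi]. *)
Lemma leb3_Rintegral_eq0 :
  (forall b c, \int[leb]_a (w ((a, b), c))%:E = 0)%E \/
  (forall a c, \int[leb]_b (w ((a, b), c))%:E = 0)%E ->
  Rintegral leb3 setT w = 0.
Proof.
move=> w0; rewrite /Rintegral; suff -> : (\int[leb3]_x (w x)%:E = 0)%E by [].
have E := @integral21_prod_meas1 _ _ (measurableTypeR R * measurableTypeR R)%type
  (measurableTypeR R) R leb2 leb _ compact_leb3_integrable. 
apply: etrans (esym E) _.
apply: integral0_eq => c _; rewrite /fubini_G /=.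
case: w0 => w0.
  apply: etrans (esym (integral21_prod_meas1 (compact_slice_integrable c))) _.
  by apply: integral0_eq => b _; exact: w0.
apply: etrans (esym (integral12_prod_meas1 (compact_slice_integrable c))) _.
by apply: integral0_eq => a _; exact: w0.
Qed.

End box.
Lemma normr_fst11 (x : @R3 R) : `|x.1.1| <= `|x|.
Proof. by rewrite !prod_normE !le_max lexx. Qed.

Lemma normr_fst12 (x : @R3 R) : `|x.1.2| <= `|x|.
Proof. by rewrite !prod_normE !le_max lexx !orbT. Qed.

Lemma normr_snd3 (x : @R3 R) : `|x.2| <= `|x|.
Proof. by rewrite prod_normE le_max lexx orbT. Qed.

Lemma derive_eq0_outside (psi : @R3 R -> R) (r : R) v x :
  (forall x, r < `|x| -> psi x = 0) -> r < `|x| -> 'D_v psi x = 0.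
Proof.
move=> psi0 rx; rewrite -(@derive_cst _ _ _ (0 : R) x v).
apply: near_eq_derive => //; near=> y; apply: psi0.
by near: y; apply: cvgr_norm_gt rx; exact: cvg_id.
Unshelve. all: by end_near. Qed.

(** [vel] is only known to be Hölder continuous, so it is never differentiated: on a line parallel
    to the differentiated variable it is a constant factor, and the integrand is the derivative of a
    compactly supported function. *)
Lemma velocity_divergence_free (t : R) (psi : @R3 R -> R) : test_fun psi ->
  Rintegral leb3 setT (fun x => dot (U3 t x) (grad psi x)) = 0.
Proof.
move=> [spsi [r0 psi0]]; pose r := `|r0| + 1.
have r_gt0 : 0 < r by rewrite ltr_pwDr.
have {}psi0 x : r < `|x| -> psi x = 0.
  move=> rx; apply: psi0; apply: le_lt_trans rx.
  by rewrite (le_trans (ler_norm r0))// lerDl.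
have outl (x : @R3 R) : (r < `|x.1.1|) || (r < `|x.1.2|) || (r < `|x.2|) -> r < `|x|.
  by move=> /orP[/orP[]|] /lt_le_trans; apply; [exact: normr_fst11|
    exact: normr_fst12|exact: normr_snd3].
have cd i : continuous (fun x : @R3 R => 'D_(ebasis i) psi x).
  exact: smooth_continuous_derive.
pose w0 (x : @R3 R) := vel t x.1.2 * 'D_(ebasis o0) psi x.
pose w1 (x : @R3 R) := vel t x.1.1 * 'D_(ebasis o1) psi x.
have cw0 : continuous w0.
  by apply: continuousMf (cd o0); exact: (continuous_slice (t := t) continuous_vel2).
have cw1 : continuous w1.
  by apply: continuousMf (cd o1); exact: (continuous_slice (t := t) continuous_vel1).
have out0 x : (r < `|x.1.1|) || (r < `|x.1.2|) || (r < `|x.2|) -> w0 x = 0.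
  by move=> /outl rx; rewrite /w0 (derive_eq0_outside _ psi0 rx) mulr0.
have out1 x : (r < `|x.1.1|) || (r < `|x.1.2|) || (r < `|x.2|) -> w1 x = 0.
  by move=> /outl rx; rewrite /w1 (derive_eq0_outside _ psi0 rx) mulr0.
rewrite (_ : (fun _ => _) = fun x => w0 x + w1 x); last first.
  by apply/funext => x; rewrite /dot sum_ord3 /coord/= mul0r addr0.
have E0 : Rintegral leb3 setT w0 = 0.
  apply: (leb3_Rintegral_eq0 cw0 out0).
  left=> b c; apply: (@integral_derivative_compact (fun a => vel t b * psi ((a, b), c)) _ r) => //.
  - move=> a; apply: (@continuous_comp _ _ _ (fun a => ((a, b), c)) w0); last exact: cw0.
    apply: continuous_pair => ?; last exact: cvg_cst.
    by apply: continuous_pair => ?; [exact: cvg_id|exact: cvg_cst].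
  - move=> a; apply: is_deriveZ.
    have dp : differentiable psi ((a, b), c) by exact: smooth_differentiable.
    have dpath : is_derive a (1 : R) (fun a : R => ((a, b), c)) (ebasis o0).
      apply: (@is_derive_pair R (R * R)%type R (fun a => (a, b)) (fun=> c)).
      exact: (@is_derive_pair R R R id (fun=> b)).
    exact: (is_derive_comp_path dp dpath).
  - move=> a ra; have rx : (r < `|((a, b), c).1.1|) || (r < `|((a, b), c).1.2|) ||
        (r < `|((a, b), c).2|) by rewrite /= ra.
    by rewrite out0// psi0 ?mulr0//; exact: outl.
apply: etrans (RintegralD measurableT (compact_leb3_integrable cw0 out0)
  (compact_leb3_integrable cw1 out1)) _.
rewrite -[RHS]addr0; congr (_ + _); first exact: E0.
apply: (leb3_Rintegral_eq0 cw1 out1).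
right=> a c; apply: (@integral_derivative_compact (fun b => vel t a * psi ((a, b), c)) _ r) => //.
- move=> b; apply: (@continuous_comp _ _ _ (fun b => ((a, b), c)) w1); last exact: cw1.
  apply: continuous_pair => ?; last exact: cvg_cst.
  by apply: continuous_pair => ?; [exact: cvg_cst|exact: cvg_id].
- move=> b; apply: is_deriveZ.
  have dp : differentiable psi ((a, b), c) by exact: smooth_differentiable.
  have dpath : is_derive b (1 : R) (fun b : R => ((a, b), c)) (ebasis o1).
    apply: (@is_derive_pair R (R * R)%type R (fun b => (a, b)) (fun=> c)).
    exact: (@is_derive_pair R R R (fun=> a) id).
  exact: (is_derive_comp_path dp dpath).
- move=> b rb; have rx : (r < `|((a, b), c).1.1|) || (r < `|((a, b), c).1.2|) ||
      (r < `|((a, b), c).2|) by rewrite /= rb orbT.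
  by rewrite out1// psi0 ?mulr0//; exact: outl.
Qed.

End divergence_free.

(** * Hausdorff dimension *)

Section hausdorff.
Context {R : realType}.
Implicit Types A C : set (@R3 R).

Lemma enorm_ge0 (x : @R3 R) : 0 <= enorm x.
Proof. exact: sqrtr_ge0. Qed.

Lemma enormE (x : @R3 R) : enorm x = Num.sqrt (x.1.1 ^+ 2 + x.1.2 ^+ 2 + x.2 ^+ 2).
Proof. by rewrite /enorm /dot sum_ord3 /coord/= !expr2. Qed.

Lemma enorm_le (x : @R3 R) : enorm x <= `|x.1.1| + `|x.1.2| + `|x.2|.
Proof.
rewrite enormE -[leRHS]ger0_norm; last by rewrite !addr_ge0.
rewrite -sqrtr_sqr; apply: ler_wsqrtr.
rewrite -(real_normK (num_real x.1.1)) -(real_normK (num_real x.1.2)) -(real_normK (num_real x.2)).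
have := normr_ge0 x.1.1; have := normr_ge0 x.1.2; have := normr_ge0 x.2.
move: `|x.1.1| `|x.1.2| `|x.2| => a b c c0 b0 a0.
have := mulr_ge0 a0 b0; have := mulr_ge0 a0 c0; have := mulr_ge0 b0 c0; lra.
Qed.

Lemma normr_le_sqrt (y z : R) : 0 <= z -> y ^+ 2 <= z -> `|y| <= Num.sqrt z.
Proof. by move=> z0 /ler_wsqrtr; rewrite sqrtr_sqr. Qed.

Lemma coord11_le_enorm (x : @R3 R) : `|x.1.1| <= enorm x.
Proof.
rewrite enormE normr_le_sqrt ?addr_ge0 ?sqr_ge0//.
by have := sqr_ge0 x.1.2; have := sqr_ge0 x.2; lra.
Qed.

Lemma coord3_le_enorm (x : @R3 R) : `|x.2| <= enorm x.
Proof.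
rewrite enormE normr_le_sqrt ?addr_ge0 ?sqr_ge0//.
by have := sqr_ge0 x.1.2; have := sqr_ge0 x.1.1; lra.
Qed.

Lemma diam_le C (d : R) : (forall x y, C x -> C y -> enorm (x - y) <= d) ->
  (Defs.diam C <= d%:E)%E.
Proof.
by move=> Cd; apply: ge_ereal_sup => _ [x Cx] [y Cy] <-; rewrite lee_fin Cd.
Qed.

Lemma enorm_le_diam C x y : C x -> C y -> ((enorm (x - y))%:E <= Defs.diam C)%E.
Proof. by move=> Cx Cy; apply: ereal_sup_ubound; exists x => //; exists y. Qed.

Lemma diam_ge0 C x : C x -> (0 <= Defs.diam C)%E.
Proof. by move=> Cx; apply: le_trans (enorm_le_diam Cx Cx); rewrite lee_fin enorm_ge0. Qed.

Lemma hterm_ge0 (s : R) C : (0 <= hterm s C)%E.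
Proof. by rewrite /hterm; case: ifP => // _; rewrite lee_fin powR_ge0. Qed.

Lemma hterm_le (s d : R) C : 0 <= s -> 0 <= d -> (Defs.diam C <= d%:E)%E ->
  (hterm s C <= (d `^ s)%:E)%E.
Proof.
move=> s0 d0 Cd; rewrite /hterm; case: asboolP => C0; first by rewrite lee_fin powR_ge0.
have [x Cx] : C !=set0 by apply/set0P/eqP.
have D0 := diam_ge0 Cx.
have Df : Defs.diam C \is a fin_num by rewrite ge0_fin_numE// (le_lt_trans Cd)// ltry.
rewrite lee_fin; apply: ge0_ler_powR; rewrite ?nnegrE ?fine_ge0//.
by rewrite -lee_fin fineK.
Qed.

Lemma hausdorff_pre_ge0 (s d : R) A : (0 <= hausdorff_pre s d A)%E.
Proof.
apply: le_ereal_inf_tmp => _ [C _ <-]; apply: nneseries_ge0 => n _ _.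
exact: hterm_ge0.
Qed.

(** The cover at stage [n] has sum at most [M * L ^ s * (n + 1) ^ (k - s)], which tends to 0 because
    [k < s]. *)
Lemma hausdorff_measure_eq0 A (k M : nat) (L s : R) : 0 < L -> k%:R < s ->
  (forall n, exists C : nat -> set R3,
     A `<=` \bigcup_(i in [set i | (i < M * n.+1 ^ k)%N]) C i /\
     forall i, (Defs.diam (C i) <= (L / n.+1%:R)%:E)%E) ->
  hausdorff_measure s A = 0%E.
Proof.
move=> L0 ks Acov; have s0 : 0 < s by apply: le_lt_trans ks.
suff pre0 d : 0 < d -> hausdorff_pre s d A = 0%E.
  apply/eqP; rewrite eq_le; apply/andP; split.
    by apply: ge_ereal_sup => _ [d /= d0 <-]; rewrite pre0.
  apply: ereal_sup_ubound; exists 1; [exact: ltr01|exact: pre0].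
move=> d0; apply/eqP; rewrite eq_le hausdorff_pre_ge0 andbT.
apply/lee_addgt0Pr => e e0; rewrite add0e.
pose X := M%:R * L `^ s / e.
have X0 : 0 <= X by rewrite /X divr_ge0 ?mulr_ge0 ?powR_ge0// ltW.
have sk : 0 < s - k%:R by rewrite subr_gt0.
pose Y := X `^ (s - k%:R)^-1.
have Y0 : 0 <= Y by exact: powR_ge0.
(* Beyond [Y] the power [(n + 1) ^ (s - k)] is at least [X], which bounds the sum by [e]; beyond
   [L / d] the pieces have diameter at most [d]. *)
pose n := Num.bound (Y + L / d).
have nYL : Y + L / d < n%:R by rewrite archi_boundP// addr_ge0// divr_ge0// ltW.
have n1 : n%:R <= n.+1%:R :> R by rewrite ler_nat.
have Ld0 : 0 < L / d by rewrite divr_gt0.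
have np : 0 < n.+1%:R :> R by rewrite ltr0n.
have Lnd : L / n.+1%:R <= d.
  by rewrite ler_pdivrMr// mulrC -ler_pdivrMr//; lra.
have XY : X <= n.+1%:R `^ (s - k%:R).
  have -> : X = Y `^ (s - k%:R).
    by rewrite /Y -powRrM mulVf ?gt_eqF// powRr1.
  by apply: ge0_ler_powR; rewrite ?nnegrE//; lra.
have [C [AC dC]] := Acov n.
pose N := (M * n.+1 ^ k)%N.
pose C' i := if (i < N)%N then C i else set0.
apply: (@le_trans _ _ (\sum_(0 <= i <oo) hterm s (C' i))%E).
  apply: ereal_inf_lbound; exists C' => //; split.
    by move=> x /AC[i /= iN Cix]; exists i => //; rewrite /C' iN.
  move=> i; rewrite /C'; case: ifP => _.
    by apply: le_trans (dC i) _; rewrite lee_fin.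
  by apply: diam_le => x y [].
rewrite (@nneseries_split _ _ 0 N); last by move=> i _; exact: hterm_ge0.
rewrite add0n [X in (_ + X)%E]eseries0 ?adde0; last first.
  move=> i Ni _; rewrite /C' ltnNge Ni/= /hterm.
  by case: asboolP.
apply: (@le_trans _ _ (\sum_(0 <= i < N) ((L / n.+1%:R) `^ s)%:E)%E).
  rewrite big_nat_cond [leRHS]big_nat_cond.
  apply: lee_sum => i /andP[/andP[_ iN] _]; rewrite /C' iN.
  by apply: hterm_le (dC i); rewrite ?ltW// divr_gt0.
rewrite sumEFin lee_fin sumr_const_nat subn0 -[_ *+ N]mulr_natl.
have np0 : n.+1%:R != 0 :> R by rewrite gt_eqF.
have pk0 : 0 < n.+1%:R `^ (s - k%:R) :> R by apply: powR_gt0.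
have -> : (L / n.+1%:R) `^ s = L `^ s / (n.+1%:R ^+ k * n.+1%:R `^ (s - k%:R)).
  rewrite powRM ?invr_ge0//; [|exact: ltW].
  congr (_ * _); rewrite -(powR_mulrn k (ler0n _ _)) -powRD ?np0 ?implybT//.
  by rewrite addrC subrK -(powR_inv1 (ler0n _ _)) -powRrM mulN1r powRN.
rewrite /N natrM natrX.
have cancel (a b c l : R) : b != 0 -> c != 0 -> a * b * (l / (b * c)) = a * l / c.
  by move=> b0 c0; field; rewrite b0 c0.
rewrite cancel ?expf_neq0// ?gt_eqF//.
by rewrite ler_pdivrMr// -ler_pdivrMl// mulrC.
Qed.

(** A mass distribution argument through the projection [p]: a cover of [A] projects to a cover of
    [E], and a piece of diameter [r <= 1] contributes at most [kappa * r ^ k <= kappa * r ^ s], so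
    the sums of the cover cannot be arbitrarily small. *)
Lemma hausdorff_measure_neq0 d (T : measurableType d) (mu : {measure set T -> \bar R})
    (p : @R3 R -> T) A (E : set T) (k : nat) (kappa m s : R) :
  (0 < k)%N -> 0 <= kappa -> 0 < m -> measurable E -> (m%:E <= mu E)%E -> E `<=` p @` A ->
  (forall (C : set R3) x (r : R), 0 <= r -> C x ->
     (forall y, C y -> enorm (y - x) <= r) ->
     exists B, [/\ measurable B, p @` C `<=` B & (mu B <= (kappa * r ^+ k)%:E)%E]) ->
  0 <= s -> s <= k%:R -> hausdorff_measure s A <> 0%E.
Proof.
move=> k0 kappa0 m0 mE mE_le EA cov s0 sk HA0.
have pre0 : (hausdorff_pre s 1 A <= 0)%E.
  by rewrite -HA0; apply: ereal_sup_ubound; exists 1 => //=; exact: ltr01.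
(* Adding 1 allows [kappa = 0] and makes [kappa * e < m] strict. *)
pose e := m / (kappa + 1).
have kp : 0 < kappa + 1 by rewrite ltr_wpDl.
have e0 : 0 < e by rewrite divr_gt0.
have e0' : (0 < e%:E)%E by rewrite lte_fin.
have [_ [C [AC dC] <-] sumC] := ereal_inf_lt (le_lt_trans pre0 e0').
have BP n : exists B, [/\ measurable B, p @` C n `<=` B & (mu B <= kappa%:E * hterm s (C n))%E].
  have [C0|/eqP/set0P[x Cx]] := pselect (C n = set0).
    exists set0; split => //; first by rewrite C0 image_set0.
    by rewrite measure0 mule_ge0// hterm_ge0.
  have D0 := diam_ge0 Cx.
  have Df : Defs.diam (C n) \is a fin_num.
    by rewrite ge0_fin_numE// (le_lt_trans (dC n))// ltry.
  pose r := fine (Defs.diam (C n)).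
  have r0 : 0 <= r by exact: fine_ge0.
  have r1 : r <= 1 by rewrite -lee_fin fineK.
  have [|B [mB pB muB]] := cov (C n) x r r0 Cx.
    by move=> y Cy; rewrite -lee_fin fineK// enorm_le_diam.
  exists B; split => //; apply: le_trans muB _.
  rewrite /hterm; case: asboolP => [C0|_]; first by rewrite C0 in Cx.
  rewrite -EFinM lee_fin ler_wpM2l// -/r.
  move: r0; rewrite le_eqVlt => /predU1P[<-|r0]; first by rewrite expr0n gtn_eqF// powR_ge0.
  have r01 : 0 < r <= 1 by rewrite r0.
  by rewrite -(powR_mulrn k (ltW r0)); exact: (ger_powR r01 sk).
pose B n := xget set0 [set B | [/\ measurable B, p @` C n `<=` B &
  (mu B <= kappa%:E * hterm s (C n))%E]].
have BH n : [/\ measurable (B n), p @` C n `<=` B n &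
    (mu (B n) <= kappa%:E * hterm s (C n))%E].
  by rewrite /B; case: xgetP => [b _ //|none']; have [b /none'] := BP n.
have : (mu E <= \sum_(0 <= n <oo) mu (B n))%E.
  apply: measure_sigma_subadditive => //; first by move=> n; have [] := BH n.
  move=> _ /EA [x Ax <-]; have [n _ Cnx] := AC _ Ax.
  by exists n => //; have [_ + _] := BH n; apply; exists x.
move=> /(le_trans mE_le); apply/negP; rewrite -ltNge.
apply: (@le_lt_trans _ _ (kappa%:E * \sum_(0 <= n <oo) hterm s (C n))%E).
  rewrite -nneseriesZl; last by move=> i _; exact: hterm_ge0.
  by apply: lee_nneseries => // n _; have [] := BH n.
apply: (@le_lt_trans _ _ (kappa%:E * e%:E)%E); first by rewrite lee_wpmul2l// ltW.
rewrite -EFinM lte_fin /e mulrA ltr_pdivrMr//; lra.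
Qed.

Lemma hausdorff_dimE A (k : nat) :
  (forall s : R, 0 <= s -> s < k%:R -> hausdorff_measure s A <> 0%E) ->
  (forall s : R, k%:R < s -> hausdorff_measure s A = 0%E) ->
  hausdorff_dim A = (k%:R)%:E.
Proof.
move=> lo up; apply/eqP; rewrite eq_le; apply/andP; split.
  apply/lee_addgt0Pr => e e0; rewrite -EFinD.
  apply: ereal_inf_lbound; exists (k%:R + e) => //; split; first by rewrite addr_ge0// ltW.
  by apply: up; rewrite ltrDl.
apply: le_ereal_inf_tmp => _ [s [s0 Hs] <-]; rewrite lee_fin leNgt.
by apply/negP => sk; exact: lo s0 sk Hs.
Qed.

End hausdorff.

(** * The supports at the initial and final times *)

Section supports.
Context {R : realType}.

(** If no point of the flow were in the ball, the preimage of each of its subsets would be empty.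
    The ball is one of the max norm, whence three separate inequalities. *)
Lemma vsupp_curr_near (t : R) x : vsupp (curr t) none x -> forall r : R, 0 < r ->
  exists p, [/\ `|x.1.1 - pos t p.1| < r, `|x.1.2 - pos t p.1| < r & `|x.2 - clamp p.2| < r].
Proof.
move=> xs r r0; have [A [j [mA Ar neq]]] := xs r r0.
apply: contrapT => no; apply: neq; rewrite /none /curr; case: ifP => // _.
change (unif2 (flow t @^-1` A) = 0%E); rewrite (_ : flow t @^-1` A = set0) ?measure0//.
apply/seteqP; split=> // p /Ar [[h1 h2] h3]; apply: no.
by exists p.
Qed.

Let band (a b x e : R) : set R := `[a, b]%classic `&` ball x e.

Let measurable_band a b x e : measurable (band a b x e).
Proof. by apply: measurableI; [exact: measurable_itv|exact: measurable_ball]. Qed.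

Let unif_band_gt0 (a b x e : R) : 0 <= a -> a < b -> b <= 1 -> a <= x -> x <= b -> 0 < e ->
  (0 < unif (band a b x e))%E.
Proof.
move=> a0 ab b1 ax xb e0.
pose l := Num.max a (x - e / 2); pose u := Num.min b (x + e / 2).
pose lus : set R := `[l, u]%classic.
have lu : l < u by rewrite /l /u gt_max !lt_min; apply/andP; split; apply/andP; split; lra.
have sub : lus `<=` band a b x e.
  move=> y; rewrite /lus /band /= !in_itv/= /l /u ge_max le_min.
  move=> /andP[/andP[h1 h2] /andP[h3 h4]].
  by rewrite h1 h3 /ball/= ltr_distlC; split => //; apply/andP; split; lra.
have mlus : measurable lus by exact: measurable_itv.
apply: (@lt_le_trans _ _ (unif lus)); last first.
  by apply: le_measure; rewrite ?inE//; exact: measurable_band.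
rewrite unif_itv// setIidl; last first.
  move=> y; rewrite /lus /= !in_itv/= /l /u ge_max le_min => /andP[/andP[h1 h2] /andP[h3 h4]].
  by apply/andP; split; lra.
by rewrite lebesgue_measure_itv/= lte_fin lu -EFinB lte_fin subr_gt0.
Qed.

(** In the label, [pos] jumps at 1/2; the estimate therefore compares moving particles only. *)
Lemma pos_lipschitz2 (t s s' : R) : 2 * s <= 1 -> 2 * s' <= 1 ->
  `|pos t s - pos t s'| <= 4 * `|s - s'|.
Proof.
move=> s1 s1'; rewrite /pos s1 s1' opprD addrACA subrr add0r subr_sqr normrM.
have := lag_lipschitz t t s s'; rewrite subrr normr0 add0r => h.
have h2 : `|lag t s + lag t s'| <= 2.
  rewrite ger0_norm ?addr_ge0 ?lag_ge0//.
  by have := lag_le1 t s; have := lag_le1 t s'; lra.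
have := ler_pM (normr_ge0 _) (normr_ge0 _) h h2.
by lra.
Qed.

(** A rectangle of labels and heights around [(s, z)], of positive mass, is sent into the given
    ball. *)
Lemma vsupp_curr_flow (t s z : R) : 0 <= s -> 2 * s <= 1 -> 0 <= z <= 1 ->
  vsupp (curr t) none ((pos t s, pos t s), z).
Proof.
move=> s0 s1 /andP[z0 z1] r r0.
exists (ball (((pos t s, pos t s), z) : @R3 R) r), o2; split => //.
  by apply: open_measurable_R3; exact: ball_open.
set B := ball _ _.
change (unif2 (flow t @^-1` B) <> 0%E); apply/eqP; rewrite gt_eqF//.
(* The radius [r / 4] offsets the constant of [pos_lipschitz2], and the bound 1/2 keeps to the
   moving labels. *)
pose I := band 0 2^-1 s (r / 4); pose J := band 0 1 z r.
have r4 : 0 < r / 4 by rewrite divr_gt0.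
have I0 : (0 < unif I)%E by apply: unif_band_gt0 => //; lra.
have J0 : (0 < unif J)%E by apply: unif_band_gt0 => //; lra.
have mI : measurable I by exact: measurable_band.
have mJ : measurable J by exact: measurable_band.
apply: (@lt_le_trans _ _ (unif2 (I `*` J))).
  rewrite (_ : unif2 _ = unif I * unif J)%E; last exact: product_measure1E.
  exact: mule_gt0.
apply: le_measure; rewrite ?inE.
- exact: measurableX.
- rewrite -[X in measurable X]setTI; apply: measurable_flow => //.
  by apply: open_measurable_R3; exact: ball_open.
move=> [y w] [] [] /=; rewrite in_itv/= => /andP[y0 y1] sy []; rewrite /= in_itv/= => w01 zw.
have h : `|pos t s - pos t y| < r.
  move: sy; rewrite /ball/= => sy.
  by apply: le_lt_trans (pos_lipschitz2 _ _ _) _ => //; lra.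
by split; [split|]; rewrite /ball/= ?clamp_id.
Qed.

Lemma vsupp_curr_diagonal (t : R) x : vsupp (curr t) none x ->
  x.1.1 = x.1.2 /\ 0 <= x.2 <= 1.
Proof.
move=> /vsupp_curr_near near_; split.
  apply/eqP; rewrite -subr_eq0 -normr_le0; apply/ler_addgt0Pr => r r0.
  have [|p [h1 h2 _]] := near_ (r / 2); first by rewrite divr_gt0.
  rewrite (_ : _ - _ = (x.1.1 - pos t p.1) - (x.1.2 - pos t p.1)); last by ring.
  by apply: le_trans (ler_normB _ _) _; lra.
apply/andP; split; apply/ler_addgt0Pr => r /near_[p [_ _]]; rewrite ltr_distl => /andP[h1 h2].
  by have := clamp_ge0 p.2; lra.
by have := clamp_le1 p.2; lra.
Qed.

Lemma initial_support (x : @R3 R) : vsupp (curr 0) none x ->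
  [/\ x.1.1 = x.1.2, x.1.1 = 0 \/ x.1.1 = 1 & 0 <= x.2 <= 1].
Proof.
move=> xs; have [x12 x2] := vsupp_curr_diagonal xs; move/vsupp_curr_near : xs => near_.
have pos0 s : pos 0 s = 0 \/ pos 0 s = 1 :> R.
  have -> : pos 0 s = if 2 * s <= 1 then 1 else 0.
    rewrite /pos /lag clamp_id ?lexx ?ler01// sub0r (max_idPl _) ?expr0n ?addr0//.
    by rewrite oppr_le0 mulr_ge0// clamp_ge0.
  by case: ifP; [right|left].
split => //.
have [->|/eqP x0] := pselect (x.1.1 = 0); first by left.
right; apply: contrapT => /eqP x1.
(* At this radius neither 0 nor 1, the only initial positions, is close enough to [x.1.1]. *)
have [|p [h1 _ _]] := near_ (Num.min `|x.1.1| `|x.1.1 - 1|).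
  by rewrite lt_min !normr_gt0 x0 subr_eq0.
by move: h1; rewrite lt_min; case: (pos0 p.1) => ->; rewrite ?subr0 ltxx ?andbF.
Qed.

(** The range [[0, 2]] also contains the gap between the resting and the moving particles, which is
    harmless when counting cells. *)
Lemma final_support (x : @R3 R) : vsupp (curr 1) none x ->
  [/\ x.1.1 = x.1.2, 0 <= x.1.1 <= 2 & 0 <= x.2 <= 1].
Proof.
move=> xs; have [x12 x2] := vsupp_curr_diagonal xs; move/vsupp_curr_near : xs => near_.
split => //.
apply/andP; split; apply/ler_addgt0Pr => r /near_[p [+ _ _]]; rewrite ltr_distl => /andP[h1 h2].
  by have := pos_ge0 1 p.1; lra.
by have := pos_le2 1 p.1; lra.
Qed.

End supports.

(** * The two dimensions: grid cells from above, projections from below *)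

Section dimensions.
Context {R : realType}.

Definition cell (n q : nat) : set R := [set y | q%:R / n.+1%:R <= y <= q.+1%:R / n.+1%:R].

(** The endpoint [y = m] gets the cell of index [m * n.+1], whence the factor [m.+1] in the
    count. *)
Lemma cell_exists (m n : nat) (y : R) : 0 <= y <= m%:R ->
  exists2 q, (q < m.+1 * n.+1)%N & cell n q y.
Proof.
move=> /andP[y0 ym]; have np : 0 < n.+1%:R :> R by rewrite ltr0n.
have yn0 : 0 <= y * n.+1%:R by rewrite mulr_ge0.
have /andP[h1 h2] := truncn_itv yn0.
exists (Num.truncn (y * n.+1%:R)).
  rewrite -(ltr_nat R); apply: le_lt_trans h1 _; rewrite natrM ltr_pM2r//.
  by apply: le_lt_trans ym _; rewrite ltr_nat.
by rewrite /cell /= ler_pdivrMr// ler_pdivlMr// h1 ltW.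
Qed.

Lemma cell_dist (n q : nat) (y z : R) : cell n q y -> cell n q z -> `|y - z| <= n.+1%:R^-1.
Proof.
have -> : n.+1%:R^-1 = q.+1%:R / n.+1%:R - q%:R / n.+1%:R :> R.
  by rewrite -mulrBl -natrB// subSnn mul1r.
rewrite /cell /=; move: (q.+1%:R / n.+1%:R) (q%:R / n.+1%:R) => a b.
move=> /andP[h1 h2] /andP[h3 h4].
by rewrite ler_norml; apply/andP; split; lra.
Qed.

Lemma hausdorff_initial (s : R) : 1 < s -> hausdorff_measure s (vsupp (curr 0) none) = 0%E.
Proof.
move=> s1; apply: (@hausdorff_measure_eq0 _ _ 1 4 1) => // n.
(* The parity of [i] selects the segment over 0 or over 1 and [i %/ 2] the vertical cell: two
   segments with [2 * n.+1] cells each give the factor 4. *)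
exists (fun i => [set x | [/\ x.1.1 = (i %% 2)%:R, x.1.2 = (i %% 2)%:R &
  cell n (i %/ 2) x.2]]); split.
  move=> x /initial_support[x12 x01 /(cell_exists n (m := 1))[q qn xq]].
  have [b b2 xb] : exists2 b, (b < 2)%N & x.1.1 = b%:R.
    by case: x01 => ->; [exists 0%N|exists 1%N].
  exists (q * 2 + b)%N; first by rewrite /= expn1; move: qn b2; lia.
  by rewrite /= -x12 modnMDl divnMDl// modn_small// divn_small// addn0.
move=> i; apply: diam_le => x y [x1 x2 xq] [y1 y2 yq]; apply: le_trans (enorm_le _) _.
change (`|x.1.1 - y.1.1| + `|x.1.2 - y.1.2| + `|x.2 - y.2| <= 1 / n.+1%:R).
by rewrite x1 x2 y1 y2 subrr normr0 !add0r div1r (cell_dist xq yq).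
Qed.

Lemma hausdorff_final (s : R) : 2 < s -> hausdorff_measure s (vsupp (curr 1) none) = 0%E.
Proof.
move=> s2; apply: (@hausdorff_measure_eq0 _ _ 2 6 3) => // n.
(* [W] is the number of vertical cells; an index is [a * W + q] with [a < 3 * n.+1], which gives
   [6 * n.+1 ^ 2] pieces. *)
pose W := (2 * n.+1)%N.
exists (fun i => [set x | [/\ x.1.1 = x.1.2, cell n (i %/ W) x.1.1 & cell n (i %% W) x.2]]).
split.
  move=> x /final_support[x12 /(cell_exists n (m := 2))[a an xa]].
  move=> /(cell_exists n (m := 1))[q qn xq].
  exists (a * W + q)%N; last by rewrite /= modnMDl divnMDl// modn_small// divn_small// addn0.
  by rewrite /= /W expnS expn1; move: qn an; nia.
move=> i; apply: diam_le => x y [x1 x2 xq] [y1 y2 yq]; apply: le_trans (enorm_le _) _.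
change (`|x.1.1 - y.1.1| + `|x.1.2 - y.1.2| + `|x.2 - y.2| <= 3 / n.+1%:R).
rewrite -x1 -y1; have := cell_dist x2 y2; have := cell_dist xq yq.
by move: (n.+1%:R^-1 : R) => d; lra.
Qed.

Lemma leb_centered (x r : R) : 0 <= r ->
  lebesgue_measure (`[x - r, x + r]%classic : set (measurableTypeR R)) = (2 * r)%:E.
Proof.
move=> r0; rewrite lebesgue_measure_itv/= lte_fin; case: ltP => h.
  by rewrite -EFinB; congr _%:E; ring.
by have -> : r = 0 by [lra]; rewrite mulr0.
Qed.

Lemma initial_dimension : hausdorff_dim (vsupp (curr 0) none : set (@R3 R)) = 1%:E.
Proof.
apply: (@hausdorff_dimE _ _ 1) => [s s0 s1|]; last exact: hausdorff_initial.
pose E : set (measurableTypeR R) := `[0, 1]%classic.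
(* Projection to the vertical axis, where the segment over [(1, 1)], the starting place of label 0,
   covers [[0, 1]]. The constant 2 is the length of an interval of radius 1. *)
apply: (@hausdorff_measure_neq0 _ _ (measurableTypeR R) lebesgue_measure (fun x => x.2)
    _ E 1 2 1 s) => //; last 2 first.
- move=> C x r r0 Cx Cr.
  exists (`[x.2 - r, x.2 + r]%classic : set (measurableTypeR R)); split.
  + exact: measurable_itv.
  + move=> _ [y /Cr yr <-]; rewrite /= in_itv/=.
    have := le_trans (coord3_le_enorm _) yr.
    by change (`|y.2 - x.2| <= r -> x.2 - r <= y.2 <= x.2 + r); rewrite ler_distl.
  + by rewrite expr1 -(leb_centered x.2 r0); exact: lexx.
- exact: ltW.
- exact: measurable_itv.
- suff : lebesgue_measure E = 1%:E by move=> E1; rewrite -[X in (X <= _)%E]E1; exact: lexx.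
  by rewrite /E lebesgue_measure_itv/= lte_fin ltr01 -EFinB subr0.
- move=> z; rewrite /E /= in_itv/= => z01.
  exists ((pos 0 0, pos 0 0), z) => //; apply: vsupp_curr_flow => //; lra.
Qed.

Lemma final_dimension : hausdorff_dim (vsupp (curr 1) none : set (@R3 R)) = 2%:E.
Proof.
apply: (@hausdorff_dimE _ _ 2) => [s s0 s2|]; last exact: hausdorff_final.
pose I : set (measurableTypeR R) := `[1, 2]%classic.
pose J : set (measurableTypeR R) := `[0, 1]%classic.
have mI : measurable I by exact: measurable_itv.
have mJ : measurable J by exact: measurable_itv.
(* Projection to the first and third coordinates; 4 is the area of a square of half-side 1. *)
apply: (@hausdorff_measure_neq0 _ _ (measurableTypeR R * measurableTypeR R)%type
    (@leb2 R) (fun x => (x.1.1, x.2)) _ (I `*` J) 2 4 1 s) => //; last 2 first.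
- move=> C x r r0 Cx Cr.
  pose B1 : set (measurableTypeR R) := `[x.1.1 - r, x.1.1 + r]%classic.
  pose B2 : set (measurableTypeR R) := `[x.2 - r, x.2 + r]%classic.
  have mB1 : measurable B1 by exact: measurable_itv.
  have mB2 : measurable B2 by exact: measurable_itv.
  exists (B1 `*` B2); split.
  + exact: measurableX.
  + move=> _ [y /Cr yr <-]; split; rewrite /B1 /B2 /= in_itv/=.
      have := le_trans (coord11_le_enorm _) yr.
      by change (`|y.1.1 - x.1.1| <= r -> x.1.1 - r <= y.1.1 <= x.1.1 + r); rewrite ler_distl.
    have := le_trans (coord3_le_enorm _) yr.
    by change (`|y.2 - x.2| <= r -> x.2 - r <= y.2 <= x.2 + r); rewrite ler_distl.
  + have Beq : leb2 (B1 `*` B2) = (4 * r ^+ 2)%:E.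
      rewrite [LHS](product_measure1E lebesgue_measure lebesgue_measure mB1 mB2).
      rewrite (_ : 4 * r ^+ 2 = (2 * r) * (2 * r)); last by ring.
      by rewrite EFinM; congr (_ * _)%E; exact: leb_centered.
    by rewrite -Beq; exact: lexx.
- exact: ltW.
- exact: measurableX.
- have EI : lebesgue_measure I = 1%:E.
    rewrite /I lebesgue_measure_itv/= lte_fin ifT; last by lra.
    by rewrite -EFinB; congr _%:E; lra.
  have EJ : lebesgue_measure J = 1%:E.
    by rewrite /J lebesgue_measure_itv/= lte_fin ltr01 -EFinB subr0.
  have IJ : leb2 (I `*` J) = 1%:E.
    rewrite [LHS](product_measure1E lebesgue_measure lebesgue_measure mI mJ).
    by rewrite [X in (X * _)%E]EI [X in (_ * X)%E]EJ mule1.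
  by rewrite -[X in (X <= _)%E]IJ; exact: lexx.
- move=> [x z] [] /=; rewrite /I /J /= !in_itv/= => /andP[x1 x2] z01.
  pose a := Num.sqrt (x - 1); have a0 : 0 <= a by exact: sqrtr_ge0.
  have aE : a ^+ 2 = x - 1 by rewrite sqr_sqrtr// subr_ge0.
  have a1 : a <= 1 by nra.
  (* The label that solves [1 + (1 - 2 s) ^ 2 = x], the particle found at [x] at time 1. *)
  pose s' := (1 - a) / 2.
  have posE : pos 1 s' = x.
    rewrite /pos /lag !clamp_id; [|by apply/andP; split; rewrite /s'; lra..].
    rewrite ifT; last by rewrite /s'; lra.
    by rewrite (max_idPr _) /s'; lra.
  exists ((pos 1 s', pos 1 s'), z); last by rewrite /= posE.
  by apply: vsupp_curr_flow => //; rewrite /s'; lra.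
Qed.

End dimensions.

(** * Local finiteness, integrability of the kernel and conclusion *)

Section assembly.
Context {R : realType}.

Lemma measurable_enorm : measurable_fun setT (@enorm R).
Proof.
rewrite (_ : @enorm R = fun x => Num.sqrt (x.1.1 ^+ 2 + x.1.2 ^+ 2 + x.2 ^+ 2)); last first.
  by apply/funext => x; exact: enormE.
apply: (measurableT_comp (continuous_measurable_fun (@sqrt_continuous R))).
by apply: measurable_funD; [apply: measurable_funD|]; apply: measurable_funX => //;
  exact: measurableT_comp.
Qed.

Lemma measurable_enorm_ball (r : R) : measurable [set x : @R3 R | enorm x <= r].
Proof.
rewrite (_ : mkset _ = setT `&` @enorm R @^-1` `]-oo, r]%classic).
  by apply: measurable_enorm => //; exact: measurable_itv.
by rewrite setTI; apply/seteqP; split=> x; rewrite /= in_itv.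
Qed.

Lemma probability_locally_finite (P : probability (@R3 R) R) : locally_finite P.
Proof.
move=> r; apply: le_lt_trans (ltry 1); apply: (@probability_le1 _ _ _ P).
exact: measurable_enorm_ball.
Qed.

Lemma zero3_locally_finite : locally_finite (@zero3 R).
Proof. by move=> r; exact: ltry. Qed.

Lemma curr_locally_finite (t : R) j : locally_finite (curr t j).
Proof.
rewrite /curr; case: ifP => _; last exact: zero3_locally_finite.
exact: (probability_locally_finite (distribution unif2 (flow t))).
Qed.

Lemma source_locally_finite (z t : R) : locally_finite (source z t).
Proof. exact: (probability_locally_finite (distribution unif (edge z t))). Qed.

Lemma continuous_K3 i j : continuous (@K3 R i j).
Proof.
rewrite /K3; case: (val j == 2%N); last by move=> x; exact: cvg_cst.
have ck (g : @R3 R -> R) : continuous g -> continuous (fun x => kern (g x)).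
  by move=> cg x; apply: (@continuous_comp _ _ _ g kern); [exact: cg|exact: continuous_kern].
case: i => -[|[|k]] ? /=; last by move=> x; exact: cvg_cst.
- by apply: ck => x; apply: continuous_comp; [exact: cvg_fst|exact: cvg_snd].
- by apply: ck => x; apply: continuous_comp; exact: cvg_fst.
Qed.

Lemma zero3_integrable (f : @R3 R -> R) : measurable_fun setT f ->
  (@zero3 R).-integrable setT (EFin \o f).
Proof.
move=> mf; apply/integrableP; split; first exact/measurable_EFinP.
by rewrite integral_measure_zero ltry.
Qed.

Lemma continuous_K3_shift i j (x : @R3 R) : continuous (fun y : @R3 R => K3 i j (x - y)).
Proof.
move=> y; apply: (@continuous_comp _ _ _ (fun y : @R3 R => x - y) (@K3 R i j)).
  by apply: (@cvgB R (@R3 R)); [exact: cvg_cst|exact: cvg_id].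
exact: continuous_K3.
Qed.

Lemma K3_integrable (t : R) i j k (x : @R3 R) :
  (curr t k).-integrable setT (fun y => (K3 i j (x - y))%:E).
Proof.
have cK := @continuous_K3_shift i j x.
rewrite /curr; case: ifP => _; last first.
  by apply: zero3_integrable; exact: continuous_measurable_R3.
have [C hC] := continuous_flow_bounded t cK.
exact: (@distribution_integrable _ _ _ unif2 (flow t) _ C (continuous_measurable_R3 cK) hC).
Qed.

End assembly.

Theorem theorem4 (R : realType) :
  exists (K : 'I_3 -> 'I_3 -> @R3 R -> R) (T : R)
         (mp mn : R -> 'I_3 -> {measure set @R3 R -> \bar R})
         (np nn : R -> {measure set @R3 R -> \bar R}),
  (forall i j, continuous (K i j)) /\
      0 < T /\
      (forall t, t \in `[0, T] -> forall j,
          locally_finite (mp t j) /\ locally_finite (mn t j)) /\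
      (forall t, t \in `[0, T] -> locally_finite (np t) /\ locally_finite (nn t)) /\
      (forall t, t \in `[0, T] -> is_divergence (mp t) (mn t) (np t) (nn t)) /\
      (forall t, t \in `[0, T] -> forall (x : R3) i j,
          (mp t j).-integrable setT (fun y => (K i j (x - y))%:E) /\
          (mn t j).-integrable setT (fun y => (K i j (x - y))%:E)) /\
      {within `[0, T] `*` [set: R3],
         continuous (fun p : R * R3 => velocity K mp mn p.1 p.2)} /\
      (forall t, t \in `[0, T] -> forall psi : R3 -> R, test_fun psi ->
          Rintegral leb3 setT (fun x => dot (velocity K mp mn t x) (grad psi x)) = 0) /\
      weakly_advected T (velocity K mp mn) mp mn np nn /\
      hausdorff_dim (vsupp (mp 0) (mn 0)) = 1%:E /\
      hausdorff_dim (vsupp (mp T) (mn T)) = 2%:E.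
Proof.
exists K3, 1, curr, (fun=> none), (source 0), (source 1).
split; first exact: continuous_K3.
split; first exact: ltr01.
split; first by move=> t _ j; split; [exact: curr_locally_finite|exact: zero3_locally_finite].
split; first by move=> t _; split; exact: source_locally_finite.
split; first by move=> t _; exact: divergence_curr.
split.
  move=> t _ x i j; split; first exact: K3_integrable.
  apply: zero3_integrable; apply: continuous_measurable_R3; exact: continuous_K3_shift.
split; first by rewrite velocityE; apply: continuous_subspaceT; exact: continuous_U3.
split; first by rewrite velocityE => t _ psi; exact: velocity_divergence_free.
split; first exact: curr_weakly_advected.
by split; [exact: initial_dimension|exact: final_dimension].
Qed.
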